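(* Let $\alpha\in(0,1)$, $d\ge1$, and let $J=[0,T]$ for some $T>0$ or $J=[0,\infty)$. (i) Consider the triangular system ${}^{C}D^\alpha_{0+}x_i(t)=f_i(t,x_1(t),\dots,x_i(t))$, $i=1,\dots,d$, $t\in J$, where each $f_i:J\times\mathbb{R}^i\to\mathbb{R}$ is continuous and there is a continuous $L:J\to[0,\infty)$ with $|f_i(t,x_1,\dots,x_i)-f_i(t,y_1,\dots,y_i)|\le L(t)\sqrt{(x_1-y_1)^2+\cdots+(x_i-y_i)^2}$ for all $i$, $t$, $x$, $y$. Let $\phi_{0,t}:\mathbb{R}^d\to\mathbb{R}^d$, $t\in J$, be its evolution mappings. Then each $\phi_{0,t}$ is a bijection and the family $\phi_{s,t}:=\phi_{0,t}\circ\phi_{0,s}^{-1}$, $s,t\in J$, is a two-parameter flow in $\mathbb{R}^d$. (ii) If $A:J\to\mathbb{R}^{d\times d}$ is a bounded continuous triangular matrix function (either $a_{ij}\equiv0$ for all $i>j$ or $a_{ij}\equiv0$ for all $i<j$) with $\|A(t)\|\le L(t)$ for a continuous $L:J\to[0,\infty)$, then the linear system ${}^{C}D^\alpha_{0+}x(t)=A(t)x(t)$ generates, in the same way, a two-parameter flow in $\mathbb{R}^d$ consisting of nonsingular linear operators.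
   Context: ${}^{C}D^\alpha_{0+}$ is the Caputo fractional derivative of order $\alpha$, applied componentwise; a solution is a continuous $x:J\to\mathbb{R}^d$ satisfying the equivalent Volterra integral equation $x(t)=x(0)+\frac{1}{\Gamma(\alpha)}\int_0^t(t-\tau)^{\alpha-1}F(\tau,x(\tau))\,d\tau$ (with $F$ the right-hand side); each initial value yields a unique solution on $J$. The evolution mapping $\phi_{0,t}$ sends $x_0\in\mathbb{R}^d$ to $x(t)$, where $x(\cdot)$ is the solution with $x(0)=x_0$. A two-parameter flow in $\mathbb{R}^d$ is a family $\phi_{s,t}:\mathbb{R}^d\to\mathbb{R}^d$, $s,t\in J$, such that $(s,t,x)\mapsto\phi_{s,t}(x)$ is continuous, each $\phi_{s,t}$ is a homeomorphism of $\mathbb{R}^d$, and $\phi_{s,t}\circ\phi_{u,s}=\phi_{u,t}$ for all $u,s,t\in J$. *)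

(* Defs.v *)
From HB Require Import structures.
From mathcomp Require Import all_boot all_order all_algebra.
From mathcomp Require Import all_classical all_reals all_analysis.
From Stdlib Require Import ClassicalEpsilon.
Set Implicit Arguments. Unset Strict Implicit. Unset Printing Implicit Defensive.
Import Order.TTheory GRing.Theory Num.Theory numFieldNormedType.Exports.
Local Open Scope ring_scope.
Local Open Scope classical_set_scope.

(* The time interval J = [0, T] (T finite) or J = [0, +oo) (T = +oo). *)
Definition Jset (R : realType) (T : \bar R) : set R :=
  [set t : R | 0 <= t /\ (t%:E <= T)%E].

Definition Gamma (R : realType) (a : R) : R :=
  Rintegral (@lebesgue_measure R) `]0, +oo[%classic
    (fun s => s `^ (a - 1) * expR (- s)).

Definition enorm (R : realType) (n : nat) (v : 'cV[R]_n) : R :=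
  Num.sqrt (\sum_(j < n) (v j 0) ^+ 2).

Definition opnorm (R : realType) (d : nat) (A : 'M[R]_d) : R :=
  sup [set enorm (A *m v) | v in [set v : 'cV[R]_d | enorm v <= 1]].

(* Solution on J of the Caputo system  ^C D^alpha_{0+} x(t) = F(t, x(t)):
   a continuous x : J -> R^d satisfying, componentwise, the equivalent
   Volterra integral equation
     x(t) = x(0) + 1/Gamma(alpha) int_0^t (t - tau)^(alpha-1) F(tau, x(tau)) dtau. *)
Definition is_solution (R : realType) (d : nat) (alpha : R) (J : set R)
    (F : R -> 'cV[R]_d -> 'cV[R]_d) (x : R -> 'cV[R]_d) : Prop :=
  {within J, continuous x} /\
  forall t, J t -> forall i : 'I_d,
    (@lebesgue_measure R).-integrable `[0, t]%classic
       (fun tau => ((t - tau) `^ (alpha - 1) * F tau (x tau) i 0)%:E) /\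
    x t i 0 = x 0 i 0 + (Gamma alpha)^-1 *
      Rintegral (@lebesgue_measure R) `[0, t]%classic
        (fun tau => (t - tau) `^ (alpha - 1) * F tau (x tau) i 0).

(* Evolution mapping phi_{0,t}: x0 |-> x(t), x the (unique) solution with
   x(0) = x0 (chosen by Hilbert's epsilon). *)
Definition evol (R : realType) (d : nat) (alpha : R) (J : set R)
    (F : R -> 'cV[R]_d -> 'cV[R]_d) (t : R) (x0 : 'cV[R]_d) : 'cV[R]_d :=
  epsilon (inhabits (fun _ : R => x0))
    (fun x => is_solution alpha J F x /\ x 0 = x0) t.

Definition homeomorphism (T U : topologicalType) (f : T -> U) : Prop :=
  exists g : U -> T, [/\ cancel f g, cancel g f, continuous f & continuous g].

Definition two_param_flow (R : realType) (d : nat) (J : set R)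
    (phi : R -> R -> 'cV[R]_d -> 'cV[R]_d) : Prop :=
  [/\ {within [set p : R * R * 'cV[R]_d | J p.1.1 /\ J p.1.2],
        continuous (fun p : R * R * 'cV[R]_d => phi p.1.1 p.1.2 p.2)},
      (forall s t, J s -> J t -> homeomorphism (phi s t)) &
      (forall u s t, J u -> J s -> J t -> phi s t \o phi u s = phi u t)].

(* Right-hand side of the triangular system: component i (0-based) is
   f_i(t, x_0, ..., x_i). *)
Definition tri_field (R : realType) (d : nat)
    (f : forall i : 'I_d, R -> 'cV[R]_i.+1 -> R) (t : R) (x : 'cV[R]_d)
    : 'cV[R]_d :=
  \col_(i < d) f i t (\col_(j < i.+1) x (widen_ord (ltn_ord i) j) 0).

(* Main.v *)
(** The triangular shape reduces everything to scalar Volterra equations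
    [x t = x 0 + \int_0^t (t - s)^(alpha-1) G s (x s) ds], solved one coordinate
    after the other; the constant [1 / Gamma alpha] is absorbed into [G].

    The heart of the matter is that two solutions of a scalar equation cannot
    meet. Let [u] be their difference, [u 0 > 0], so that [u = u 0 + K h] with
    [|h| <= lam |u|], where [K] is the Abel operator. Let [e = 1 - lam K e].
    Then [e > 0], and [z = u - u 0 * e] solves [z = K (p - lam z)] with
    [p = h + lam u >= 0] as long as [u >= 0]; such a [z] is nonnegative, whence
    [u >= u 0 * e]. Nonnegativity of [z] follows by superposing the responses to
    [p] cut off to short time slices. On its own slice such a response is
    positive, and it stays positive afterwards because the ratio
    [(t' - s)^(alpha-1) / (t - s)^(alpha-1)], [t < t'], is monotone in [s].

    Together with Gronwall this gives two-sided estimates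
    [|x t - y t| <= C |x s - y s|] for all [s], [t] in a bounded interval, and
    with the intermediate value theorem a solution with prescribed value at any
    given time. Bijectivity and joint continuity of the flow follow. *)
Require Import Defs.
From HB Require Import structures.
From mathcomp Require Import all_boot all_order all_algebra.
From mathcomp Require Import all_classical all_reals all_analysis.
From mathcomp Require Import measurable_realfun zify ring lra.
Set Implicit Arguments. Unset Strict Implicit. Unset Printing Implicit Defensive.
Import Order.TTheory GRing.Theory Num.Theory numFieldNormedType.Exports.
Local Open Scope ring_scope.
Local Open Scope classical_set_scope.

(** A Caputo equation has memory: a solution cannot be restarted at a later time, nor can time be
    reversed, so uniqueness of the initial value problem does not prevent two solutions from
    agreeing at some [t > 0]. In one dimension the order of the line fills this gap: a distance that
    never closes gives injectivity, and a distance bounded below by a fixed multiple of the initial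
    one gives surjectivity. A triangular system inherits this, because coordinates solved earlier
    enter the next equation only as known functions of time. When two vector solutions are compared,
    these coordinates appear as an additive error [b], which is why the scalar estimates carry one.

    The time slices work because the input is first assumed to be at least some [eta > 0]: on a
    slice that is short in terms of [eta], the feedback [lam * w] stays below [eta / 2]. The excess
    [eta] is removed afterwards by means of [e]. The constants of the final scalar estimates depend
    on [alpha], [Lam] and [T] only, not on the right-hand side or the solutions; the induction over
    coordinates relies on this. *)

(** * The Abel kernel and its mass *)

Section AbelKernel.
Context {R : realType} (alpha : R).
Hypothesis alpha01 : 0 < alpha < 1.
Notation mu := (@lebesgue_measure R).

Let alpha_gt0 : 0 < alpha. Proof. by case/andP: alpha01. Qed.

Definition abel_ker (t tau : R) : R := (t - tau) `^ (alpha - 1).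

Local Notation ker := abel_ker.

Lemma ker_ge0 t tau : 0 <= ker t tau.
Proof. exact: powR_ge0. Qed.

Lemma is_derive_ker_prim (t tau : R) : tau < t ->
  is_derive tau 1 (fun s => - ((t - s) `^ alpha / alpha)) (ker t tau).
Proof.
move=> tt; have p : 0 < t - tau by rewrite subr_gt0.
have d1 : is_derive tau 1 (fun s : R => t - s) (- 1).
  have -> : (-1 : R) = 0 - 1 by rewrite sub0r.
  exact: is_deriveB.
have := @is_derive1_comp R (fun y => y `^ alpha) (fun s => t - s) tau _ _
  (is_derive1_powR alpha p) d1.
move=> d2.
have d3 : is_derive tau 1 (fun s => - ((t - s) `^ alpha / alpha))
   (- (alpha^-1 *: (alpha * (t - tau) `^ (alpha - 1) * -1))).
  have -> : (fun s => - ((t - s) `^ alpha / alpha)) =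
     - (alpha^-1 *: ((powR (R:=R) ^~ alpha) \o (fun s => t - s))).
    by apply/funext => s /=; rewrite !fctE/= /GRing.scale/= mulrC.
  apply: is_deriveN.
apply: is_derive_eq d3 _; rewrite /GRing.scale/= /abel_ker.
by field; rewrite gt_eqF.
Qed.

Lemma continuous_ker (t tau : R) : tau < t -> {for tau, continuous (ker t)}.
Proof.
move=> tt; have p : 0 < t - tau by rewrite subr_gt0.
apply: (@continuous_comp _ _ _ (fun s : R => t - s) (fun y : R => y `^ (alpha - 1))).
  by apply: continuousB; [exact: cst_continuous | exact: id].
apply/differentiable_continuous/derivable1_diffP.
by apply: derivable_powR; rewrite in_itv/= p.
Qed.

Lemma integral_ker_regular (t a b : R) : a < b -> b < t ->
  (\int[mu]_(x in `[a, b]) (ker t x)%:E =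
   (((t - a) `^ alpha - (t - b) `^ alpha) / alpha)%:E)%E.
Proof.
move=> ab bt.
rewrite (@continuous_FTC2 _ _ (fun s => - ((t - s) `^ alpha / alpha)))//.
- by rewrite -EFinB; congr EFin; lra.
- apply: continuous_in_subspaceT => x; rewrite inE/= in_itv/= => /andP[_ xb].
  by apply: continuous_ker; apply: le_lt_trans bt.
- have H x : x < t -> {for x, continuous (fun s => - ((t - s) `^ alpha / alpha))}.
    move=> xt; apply/differentiable_continuous/derivable1_diffP.
    by have [] := is_derive_ker_prim xt.
  split.
  + move=> x; rewrite in_itv/= => /andP[_ xb].
    by have [] := is_derive_ker_prim (lt_trans xb bt).
  + by apply: cvg_at_right_filter; apply: H; apply: lt_trans bt.
  + by apply: cvg_at_left_filter; apply: H.
- move=> x; rewrite in_itv/= => /andP[_ xb].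
  rewrite derive1E.
  by have [_ ->] := is_derive_ker_prim (lt_trans xb bt).
Qed.

Lemma measurable_ker t (D : set R) : measurable D -> measurable_fun D (ker t).
Proof.
move=> mD; apply: (measurable_funS measurableT) => //.
apply: (@measurableT_comp _ _ _ _ _ _ (fun y : R => y `^ (alpha - 1))) => //.
by apply: measurable_funB.
Qed.

Lemma powR_cvg0_seq (c : R) : 0 < c ->
  (c / n.+2%:R) `^ alpha @[n --> \oo] --> (0 : R).
Proof.
move=> c0; apply/cvgrPdist_le => e e0.
have [N HN] : exists N : nat, c / e `^ alpha^-1 < N%:R.
  exists (Num.truncn (c / e `^ alpha^-1)).+1.
  by rewrite truncnS_gt.
have p0 : 0 < e `^ alpha^-1 by rewrite powR_gt0.
exists N => // n /= Nn; rewrite sub0r normrN ger0_norm ?powR_ge0//.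
have -> : e = (e `^ alpha^-1) `^ alpha.
  by rewrite -powRrM mulVf ?gt_eqF// powRr1// ltW.
apply: ge0_ler_powR; rewrite ?nnegrE ?ltW ?divr_gt0//.
rewrite ltr_pdivrMr// mulrC -ltr_pdivrMr//.
apply: lt_le_trans HN _; rewrite ler_nat.
by apply: leq_trans Nn _; rewrite (leq_trans (leqnSn _)).
Qed.

(** The kernel is singular at [t], so the fundamental theorem is applied on intervals that stop
    short of [t] and exhaust [[a, t[]; monotone convergence does the rest. *)
Lemma integral_ker (t a : R) : a <= t ->
  (\int[mu]_(x in `[a, t]) (ker t x)%:E = ((t - a) `^ alpha / alpha)%:E)%E.
Proof.
rewrite le_eqVlt => /predU1P[->|at_].
  rewrite set_itv1 integral_set1 subrr powR0 ?mul0r// gt_eqF//.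
have ta0 : 0 < t - a by rewrite subr_gt0.
(* With [n.+1] in place of [n.+2] the first interval would be degenerate, while
   [integral_ker_regular] asks for [a < b n]. *)
pose b n := t - (t - a) / n.+2%:R.
have bt n : b n < t by rewrite ltrBlDr ltrDl divr_gt0.
have ab n : a < b n.
  rewrite /b ltrBrDr addrC -ltrBrDr ltr_pdivrMr// ltr_pMr// ltr1n//.
pose F n := `[a, b n]%classic.
have <- : (\int[mu]_(x in `[a, t[) (ker t x)%:E =
           \int[mu]_(x in `[a, t]) (ker t x)%:E)%E.
  by apply: integral_itv_bndo_bndc; apply/measurable_EFinP; exact: measurable_ker.
have UF : `[a, t[%classic = \bigcup_n F n.
  apply/seteqP; split => x /=; rewrite ?in_itv/=.
    move=> /andP[ax xt].
    have p : 0 < t - x by rewrite subr_gt0.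
    exists (Num.truncn ((t - a) / (t - x))) => //=.
    rewrite /F/= in_itv/= ax/=.
    rewrite /b lerBrDr addrC -lerBrDr ler_pdivrMr// mulrC -ler_pdivrMr//.
    apply: le_trans (ltW (truncnS_gt _)) _.
    by rewrite ler_nat.
  move=> [n _] /=; rewrite /F/= in_itv/= => /andP[-> xb].
  exact: le_lt_trans (bt n).
rewrite UF.
apply: (@cvg_unique _ _ (\int[mu]_(x in F n) (ker t x)%:E @[n --> \oo])%E) => //.
  apply: ge0_nondecreasing_set_cvg_integral => //.
  - move=> m n mn; apply/subsetPset => x; rewrite /F/= !in_itv/= => /andP[-> xb]/=.
    apply: le_trans xb _; rewrite /b lerD2l lerN2 ler_pM2l// lef_pV2 ?posrE//.
    by rewrite ler_nat ltnS ltnS.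
  - by move=> n; exact: measurable_itv.
  - by move=> n; apply/measurable_EFinP; apply: measurable_ker; exact: measurable_itv.
  - by move=> n x _; rewrite lee_fin ker_ge0.
rewrite /=.
have -> : (fun n => \int[mu]_(x in F n) (ker t x)%:E)%E =
  EFin \o (fun n => ((t - a) `^ alpha - ((t - a) / n.+2%:R) `^ alpha) / alpha).
  apply/funext => n /=; rewrite integral_ker_regular//.
  by rewrite /b opprB addrCA subrr addr0.
apply: cvg_EFin; first by near=> n.
have -> : (t - a) `^ alpha / alpha = ((t - a) `^ alpha - 0) / alpha by rewrite subr0.
apply: cvgMl; apply: cvgB; first exact: cvg_cst.
exact: powR_cvg0_seq.
Unshelve. all: by end_near. Qed.

End AbelKernel.

(** * Admissible inputs of the Abel operator *)

Section LocallyBoundedMeasurable.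
Context {R : realType}.
Implicit Types (h g : R -> R) (t c a b s M : R).

(** Continuity would be too strong, since inputs cut off to a time slice occur. Boundedness on each
    [[0, T]] is what makes the product with the singular kernel integrable. *)
Definition lbm h := measurable_fun setT h /\
  forall T, exists M, forall t, 0 <= t <= T -> `|h t| <= M.

Lemma continuous_bounded_itv h (a b : R) : continuous h ->
  exists M, forall t, a <= t <= b -> `|h t| <= M.
Proof.
move=> ch; have [ab|ba] := leP a b; last first.
  by exists 0 => t /andP[at_ tb]; move: (le_trans at_ tb); rewrite leNgt ba.
have cn : {within `[a, b], continuous (fun t => `|h t|)}.
  apply: continuous_subspaceT => t.
  by apply: continuous_comp; [exact: ch | exact: norm_continuous].
have [c _ Hc] := EVT_max ab cn.
by exists `|h c| => t tab; apply: Hc; rewrite in_itv.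
Qed.

Lemma lbm_continuous h : continuous h -> lbm h.
Proof.
move=> ch; split; last by move=> T; exact: continuous_bounded_itv.
exact: continuous_measurable_fun.
Qed.

Lemma lbm_cst c : lbm (fun _ => c).
Proof. by apply: lbm_continuous => t; exact: cst_continuous. Qed.

Lemma lbmD h g : lbm h -> lbm g -> lbm (fun t => h t + g t).
Proof.
move=> [mh bh] [mg bg]; split; first exact: measurable_funD.
move=> T; have [M HM] := bh T; have [N HN] := bg T; exists (M + N) => t tT.
by apply: le_trans (ler_normD _ _) _; apply: lerD; [exact: HM | exact: HN].
Qed.

Lemma lbmM h g : lbm h -> lbm g -> lbm (fun t => h t * g t).
Proof.
move=> [mh bh] [mg bg]; split; first exact: measurable_funM.
move=> T; have [M HM] := bh T; have [N HN] := bg T; exists (M * N) => t tT.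
by rewrite normrM ler_pM//; [exact: HM | exact: HN].
Qed.

Lemma lbmZ c h : lbm h -> lbm (fun t => c * h t).
Proof. by move=> lh; apply: lbmM => //; exact: lbm_cst. Qed.

Lemma lbmN h : lbm h -> lbm (fun t => - h t).
Proof.
move=> /(lbmZ (-1)); rewrite (_ : (fun t => -1 * h t) = (fun t => - h t))//.
by apply/funext => t; rewrite mulN1r.
Qed.

Lemma lbmB h g : lbm h -> lbm g -> lbm (fun t => h t - g t).
Proof. by move=> lh lg; apply: lbmD => //; exact: lbmN. Qed.

Lemma lbm_norm h : lbm h -> lbm (fun t => `|h t|).
Proof.
move=> [mh bh]; split; first exact: measurableT_comp.
move=> T; have [M HM] := bh T; exists M => t tT.
by rewrite normr_id; exact: HM.
Qed.

Lemma lbm_indic (A : set R) : measurable A -> lbm (\1_A : R -> R).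
Proof.
move=> mA; split; first exact: measurable_indic.
move=> T; exists 1 => t _; rewrite indicE.
by case: (_ \in _); rewrite ?normr0 ?normr1.
Qed.

End LocallyBoundedMeasurable.

(** * The Abel operator: linearity, monotonicity, Hölder estimate *)

Section AbelOperator.
Context {R : realType} (alpha : R).
Hypothesis alpha01 : 0 < alpha < 1.
Notation mu := (@lebesgue_measure R).
Local Notation ker := (abel_ker alpha).
Implicit Types (h g : R -> R) (t c a b s M : R).

Let alpha_gt0 : 0 < alpha. Proof. by case/andP: alpha01. Qed.
Let alpha_lt1 : alpha < 1. Proof. by case/andP: alpha01. Qed.

Definition abel h t : R := Rintegral mu `[0, t]%classic (fun s => ker t s * h s).

Lemma ker_integrable (a t : R) : a <= t -> mu.-integrable `[a, t] (EFin \o ker t).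
Proof.
move=> at_; apply/integrableP; split.
  by apply/measurable_EFinP; exact: measurable_ker.
under eq_integral => x _ do rewrite /= ger0_norm ?ker_ge0//.
by rewrite integral_ker// ltry.
Qed.

Lemma abel_integrable h t a b : lbm h -> 0 <= a -> b <= t ->
  mu.-integrable `[a, b] (fun s => (ker t s * h s)%:E).
Proof.
move=> [mh bh] a0 bt.
have [t0|t0] := leP 0 t; last first.
  rewrite set_itv_ge ?bnd_simp ?integrable_set0//.
  by rewrite -ltNge (le_lt_trans bt)// (lt_le_trans t0).
apply: (@integrableS _ _ _ mu `[0, t]) => //.
  by apply: subset_itv; rewrite bnd_simp.
have [M HM] := bh t.
apply: (@integrableMl _ _ _ mu _ _ (EFin \o ker t)) => //.
- exact: ker_integrable.
- exact: measurable_funS mh.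
- exists M; split; first exact: num_real.
  move=> x Mx s /=; rewrite in_itv/= => s0t.
  by apply: le_trans (HM s s0t) _; exact: ltW.
Qed.

Lemma abelD h g t : lbm h -> lbm g -> abel (fun s => h s + g s) t = abel h t + abel g t.
Proof.
move=> lh lg; rewrite /abel -RintegralD//; try exact: abel_integrable.
by apply: eq_Rintegral => s _; rewrite mulrDr.
Qed.

Lemma abelZ c h t : lbm h -> abel (fun s => c * h s) t = c * abel h t.
Proof.
move=> lh; rewrite /abel -RintegralZl//; last exact: abel_integrable.
by apply: eq_Rintegral => s _; rewrite mulrCA.
Qed.

Lemma abelN h t : lbm h -> abel (fun s => - h s) t = - abel h t.
Proof.
move=> lh; rewrite -mulN1r -abelZ//.
by congr abel; apply/funext => s; rewrite mulN1r.
Qed.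

Lemma abelB h g t : lbm h -> lbm g -> abel (fun s => h s - g s) t = abel h t - abel g t.
Proof. by move=> lh lg; rewrite abelD ?abelN//; exact: lbmN. Qed.

(** The right endpoint is a null set and is left out of the hypothesis: at [s = t] the kernel has
    the default value 0 of [powR], and bounds such as [ler_ker] hold only for [s < t]. *)
Lemma le_Rintegral_co (a b : R) h g :
  mu.-integrable `[a, b] (EFin \o h) -> mu.-integrable `[a, b] (EFin \o g) ->
  (forall s, a <= s < b -> h s <= g s) ->
  \int[mu]_(s in `[a, b]) h s <= \int[mu]_(s in `[a, b]) g s.
Proof.
move=> ih ig hg.
have S (f : R -> R) : mu.-integrable `[a, b] (EFin \o f) ->
    mu.-integrable `[a, b[ (EFin \o f).
  by apply: integrableS => //; apply: subset_itv; rewrite bnd_simp.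
rewrite -!Rintegral_itv_bndo_bndc; [|exact: S|exact: S].
apply: le_Rintegral => //; try exact: S.
Qed.

Lemma le_abel h g t : lbm h -> lbm g -> (forall s, 0 <= s < t -> h s <= g s) ->
  abel h t <= abel g t.
Proof.
move=> lh lg hg; apply: le_Rintegral_co; try exact: abel_integrable.
by move=> s s0t; rewrite ler_wpM2l ?ker_ge0 ?hg.
Qed.

Lemma eq_abel h g t : lbm h -> lbm g -> (forall s, 0 <= s < t -> h s = g s) ->
  abel h t = abel g t.
Proof.
move=> lh lg hg; apply/eqP; rewrite eq_le; apply/andP; split; apply: le_abel => //.
  by move=> s /hg ->.
by move=> s /hg ->.
Qed.

Lemma le_norm_abel h g t : lbm h -> lbm g ->
  (forall s, 0 <= s < t -> `|h s| <= g s) -> `|abel h t| <= abel g t.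
Proof.
move=> lh lg hg; rewrite ler_norml -abelN//; apply/andP; split; apply: le_abel => //.
- exact: lbmN.
- by move=> s /hg; rewrite ler_norml => /andP[].
- by move=> s /hg; rewrite ler_norml => /andP[].
Qed.

Lemma abel_split h a t : lbm h -> 0 <= a <= t ->
  abel h t = \int[mu]_(s in `[0, a]) (ker t s * h s) +
             \int[mu]_(s in `[a, t]) (ker t s * h s).
Proof.
move=> lh /andP[a0 at_]; rewrite /abel.
have := @Rintegral_itvB R (fun s => ker t s * h s) (BLeft 0) (BRight t) a
  (abel_integrable lh (lexx 0) (lexx t)).
rewrite !bnd_simp => /(_ a0 at_) H.
rewrite -[X in _ = _ + X]Rintegral_itv_obnd_cbnd -?H; first by rewrite addrCA subrr addr0.
apply: (@integrableS _ _ _ mu `[0, t]) => //; last exact: abel_integrable.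
by apply: subset_itv; rewrite bnd_simp.
Qed.

Lemma Rintegral_ker_cst c a t : a <= t ->
  \int[mu]_(s in `[a, t]) (ker t s * c) = c * ((t - a) `^ alpha / alpha).
Proof.
move=> at_; rewrite RintegralZr//; last exact: ker_integrable.
by rewrite mulrC /Rintegral/= integral_ker.
Qed.

Lemma abel_cst c t : 0 <= t -> abel (fun _ => c) t = c * (t `^ alpha / alpha).
Proof. by move=> t0; rewrite /abel Rintegral_ker_cst// subr0. Qed.

Lemma abel0 h : abel h 0 = 0.
Proof. by rewrite /abel set_itv1 Rintegral_set1. Qed.

Lemma Rintegral_ker_ge h c a t : lbm h -> 0 <= a <= t ->
  (forall s, a <= s < t -> c <= h s) ->
  c * ((t - a) `^ alpha / alpha) <= \int[mu]_(s in `[a, t]) (ker t s * h s).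
Proof.
move=> lh /andP[a0 at_] ch; rewrite -Rintegral_ker_cst//.
apply: le_Rintegral_co.
- by apply: abel_integrable => //; exact: lbm_cst.
- exact: abel_integrable.
- by move=> s s0t; rewrite ler_wpM2l ?ker_ge0 ?ch.
Qed.

Lemma norm_Rintegral_ker_le h M a t : lbm h -> 0 <= a <= t ->
  (forall s, a <= s < t -> `|h s| <= M) ->
  `|\int[mu]_(s in `[a, t]) (ker t s * h s)| <= M * ((t - a) `^ alpha / alpha).
Proof.
move=> lh a0t hM; have /andP[a0 at_] := a0t.
rewrite ler_norml -mulNr; apply/andP; split.
  by apply: Rintegral_ker_ge => // s /hM; rewrite ler_norml => /andP[].
rewrite -Rintegral_ker_cst//; apply: le_Rintegral_co.
- exact: abel_integrable.
- by apply: abel_integrable => //; exact: lbm_cst.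
- move=> s s0t; rewrite ler_wpM2l ?ker_ge0//.
  by apply: le_trans (hM s s0t); exact: ler_norm.
Qed.

Lemma ler_ker s t t' : s < t -> t <= t' -> ker t' s <= ker t s.
Proof.
have E (x : R) : x `^ (alpha - 1) = (x `^ (1 - alpha))^-1 by rewrite -powRN opprB.
move=> st tt'; rewrite /abel_ker !E.
have p : 0 < t - s by rewrite subr_gt0.
have p' : 0 < t' - s by rewrite subr_gt0 (lt_le_trans st).
rewrite lef_pV2 ?posrE ?powR_gt0//.
by apply: ge0_ler_powR; rewrite ?nnegrE ?subr_ge0; do ?[exact: ltW | lra]; rewrite ltW.
Qed.

Lemma abel_holder h M t t' : lbm h -> 0 <= t <= t' ->
  (forall s, 0 <= s <= t' -> `|h s| <= M) ->
  `|abel h t' - abel h t| <= 2 * M * ((t' - t) `^ alpha / alpha).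
Proof.
move=> lh tt' hM; have /andP[t0 tt] := tt'.
have M0 : 0 <= M.
  by apply: le_trans (hM 0 _); rewrite ?normr_ge0 ?lexx ?(le_trans t0).
rewrite (abel_split lh tt').
set A := \int[mu]_(s in `[0, t]) (ker t' s * h s).
set B := \int[mu]_(s in `[t, t']) (ker t' s * h s).
have -> : A + B - abel h t = (A - abel h t) + B by rewrite addrAC.
apply: le_trans (ler_normD _ _) _.
have -> : 2 * M * ((t' - t) `^ alpha / alpha) =
  M * ((t' - t) `^ alpha / alpha) + M * ((t' - t) `^ alpha / alpha) by ring.
apply: lerD; last first.
  apply: norm_Rintegral_ker_le => // s /andP[ts st]; apply: hM.
  by rewrite (ltW st) (le_trans t0).
have iA (f : R -> R) : lbm f -> mu.-integrable `[0, t] (fun s => (ker t' s * f s)%:E).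
  by move=> lf; exact: abel_integrable.
have iB (f : R -> R) : lbm f -> mu.-integrable `[0, t] (fun s => (ker t s * f s)%:E).
  by move=> lf; exact: abel_integrable.
rewrite /A /abel -RintegralB//; [|exact: iA|exact: iB].
have lc : @lbm R (fun _ => M) by exact: lbm_cst.
have iD (f : R -> R) : lbm f ->
    mu.-integrable `[0, t] (EFin \o (fun s => ker t s * f s - ker t' s * f s)).
  move=> lf; apply: (@eq_integrable _ _ _ mu `[0, t] _
    (fun s => (ker t s * f s)%:E - (ker t' s * f s)%:E)%E) => //.
  by apply: integrableB => //; [exact: iB | exact: iA].
have E1 : \int[mu]_(s in `[0, t]) (ker t s * M - ker t' s * M) <=
    M * ((t' - t) `^ alpha / alpha).
  rewrite RintegralB//; [|exact: iB|exact: iA].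
  rewrite (Rintegral_ker_cst M t0).
  (* The mass of [ker t'] on [[0, t]] is the mass on [[0, t']] minus that on [[t, t']]. *)
  have := @abel_split _ t t' lc tt'.
  rewrite abel_cst ?(le_trans t0)// Rintegral_ker_cst// subr0.
  move=> /eqP; rewrite -subr_eq => /eqP <-.
  have p : t `^ alpha <= t' `^ alpha.
    by apply: ge0_ler_powR; rewrite ?nnegrE//; [exact: ltW | exact: le_trans t0 _].
  have : M * (t `^ alpha / alpha) <= M * (t' `^ alpha / alpha).
    by rewrite ler_wpM2l// ler_pM2r// invr_gt0.
  lra.
have key (f : R -> R) : lbm f -> (forall s, 0 <= s <= t' -> `|f s| <= M) ->
    \int[mu]_(s in `[0, t]) (ker t s * f s - ker t' s * f s) <=
    \int[mu]_(s in `[0, t]) (ker t s * M - ker t' s * M).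
  move=> lf fM; apply: le_Rintegral_co; [exact: iD|exact: iD|] => s /andP[s0 st].
  rewrite -!mulrBl ler_wpM2l ?subr_ge0 ?ler_ker//.
  apply: le_trans (ler_norm _) (fM _ _).
  by rewrite s0 (le_trans (ltW st)).
rewrite ler_norml; apply/andP; split.
  rewrite lerNl; apply: le_trans E1; apply: le_trans (key _ lh hM).
  rewrite -mulN1r -RintegralZl//; last first.
    rewrite (_ : _ \o _ = (-%E \o (EFin \o (fun s => ker t s * h s - ker t' s * h s)))).
      exact: (integrableN (iD _ lh)).
    by apply/funext => s /=; rewrite opprB.
  by rewrite le_eqVlt; apply/orP; left; apply/eqP; apply: eq_Rintegral => s _; ring.
apply: le_trans E1; apply: le_trans (key _ (lbmN lh) _); last first.
  by move=> s /hM; rewrite normrN.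
by rewrite le_eqVlt; apply/orP; left; apply/eqP; apply: eq_Rintegral => s _; ring.
Qed.

End AbelOperator.

(** * Clamped time and geometric convergence *)

Section RealLemmas.
Context {R : realType}.
Implicit Types (t s T : R).

(** Retraction of the line onto [[0, T]]. Composing with it turns data on an interval into functions
    on all of [R], so that plain continuity can be used instead of continuity within a set. *)
Definition clamp T t : R := Num.max 0 (Num.min T t).

Lemma clamp_itv T t : 0 <= T -> 0 <= clamp T t <= T.
Proof.
by move=> T0; rewrite /clamp; case: (leP T t) => ?; [case: (leP 0 T) | case: (leP 0 t)] => ?; lra.
Qed.

Lemma clamp_id T t : 0 <= t <= T -> clamp T t = t.
Proof.
by rewrite /clamp; case: (leP T t) => ?; [case: (leP 0 T) | case: (leP 0 t)] => ?; lra.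
Qed.

Lemma clamp_lipschitz T t s : `|clamp T t - clamp T s| <= `|t - s|.
Proof.
rewrite /clamp ler_norml.
case: (leP T t) => ?; case: (leP T s) => ?; case: (ger0P (t - s)) => ?;
  case: (leP 0 T) => ?; case: (leP 0 t) => ?; case: (leP 0 s) => ?; lra.

Qed.

Lemma continuous_clamp T : continuous (clamp T).
Proof.
move=> t; apply/cvgrPdist_le => e e0; near=> s.
apply: le_trans (clamp_lipschitz _ _ _) _.
near: s; exact: cvgr_dist_le.
Unshelve. all: by end_near. Qed.

Lemma uniform_limit_continuous_real (x : R -> R) :
  (forall e, 0 < e -> exists y : R -> R, continuous y /\ forall t, `|x t - y t| <= e) ->
  continuous x.
Proof.
move=> H t; apply/cvgrPdist_le => e e0.
have e3 : 0 < e / 3 by lra.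
have [y [cy xy]] := H _ e3.
have := cy t; move/cvgrPdist_le => /(_ _ e3) near_y.
near=> s.
have h1 : `|y t - y s| <= e / 3 by near: s.
have := xy t; have := xy s; rewrite !ler_norml in h1 *; lra.
Unshelve. all: by end_near. Qed.

Lemma geometric_small (a C : R) : (forall n, `|a| <= C * 2^-1 ^+ n) -> a = 0.
Proof.
move=> H; apply/eqP/negPn/negP => a0.
have p : 0 < `|a| by rewrite normr_gt0.
have C0 : 0 < C by have := H 0%N; rewrite expr0 mulr1; exact: lt_le_trans.
pose n := (Num.truncn (C / `|a|)).+1.
have Hn : C / `|a| < n%:R by exact: truncnS_gt.
have : C / `|a| < 2 ^+ n.
  by apply: lt_trans Hn _; rewrite -natrX ltr_nat ltn_expl.
rewrite ltr_pdivrMr// -ltr_pdivrMl ?exprn_gt0// mulrC -exprVn.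
by move/(le_lt_trans (H n)); rewrite ltxx.
Qed.

(** The steps from [n] on add up to at most [2 * C * 2^-1 ^+ n], so the intervals of this radius
    around [u n] are nested; the limit is the supremum of their left ends. *)
Lemma geometric_limit (u : nat -> R) (C : R) :
  (forall n, `|u n.+1 - u n| <= C * 2^-1 ^+ n) ->
  exists l, forall n, `|l - u n| <= 2 * C * 2^-1 ^+ n.
Proof.
move=> H.
have C0 n : 0 <= C * 2^-1 ^+ n by apply: le_trans (H n).
pose a n := u n - 2 * C * 2^-1 ^+ n; pose b n := u n + 2 * C * 2^-1 ^+ n.
have ndec n m : (n <= m)%N -> a n <= a m.
  apply: (homo_leq (@lexx _ R) (@le_trans _ R)) => k.
  by have := H k; rewrite /a exprS ler_norml; lra.
have ninc n m : (n <= m)%N -> b m <= b n.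
  move=> nm; rewrite -lerN2.
  apply: (homo_leq (f := fun k => - b k) (@lexx _ R) (@le_trans _ R)) nm => k.
  by have := H k; rewrite /b exprS ler_norml; lra.
have ab n m : a n <= b m.
  have abk k : a k <= b k by rewrite /a /b; have := C0 k; lra.
  have [nm|/ltnW mn] := leqP n m.
    exact: le_trans (ndec _ _ nm) (abk m).
  exact: le_trans (abk n) (ninc _ _ mn).
pose S := [set a n | n in [set: nat]].
have hS : has_sup S.
  by split; [exists (a 0%N); exists 0%N | exists (b 0%N) => _ [n _ <-]].
exists (sup S) => n.
have h1 : a n <= sup S by apply: ub_le_sup; [exact: hS.2 | exists n].
have h2 : sup S <= b n by apply: ge_sup; [exact: hS.1 | move=> _ [k _ <-]].
by move: h1 h2; rewrite /a /b ler_norml; lra.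
Qed.

End RealLemmas.

(** * Gronwall estimate and existence for scalar Volterra equations *)

Section Volterra.
Context {R : realType} (alpha : R).
Hypothesis alpha01 : 0 < alpha < 1.
Notation mu := (@lebesgue_measure R).
Local Notation ker := (abel_ker alpha).
Local Notation abel := (abel alpha).
Implicit Types (h g u x : R -> R) (t c a b s M T Lam lam : R).

Let alpha_gt0 : 0 < alpha. Proof. by case/andP: alpha01. Qed.

Lemma powR_root (c : R) : 0 < c -> exists2 d : R, 0 < d & d `^ alpha = c.
Proof.
move=> c0; exists (c `^ alpha^-1); first exact: powR_gt0.
by rewrite -powRrM mulVf ?gt_eqF// powRr1// ltW.
Qed.

Lemma continuous_abel h T : lbm h -> 0 <= T -> continuous (fun t => abel h (clamp T t)).
Proof.
move=> lh T0 t; apply/cvgrPdist_le => e e0.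
have [M0 HM0] := lh.2 T.
(* The bound is made positive because it is divided by: [d] below is the length at which the Hölder
   bound equals [e]. *)
pose M : R := `|M0| + 1.
have M1 : 0 < M by rewrite ltr_wpDl.
have HM s : 0 <= s <= T -> `|h s| <= M.
  by move=> /HM0 /le_trans; apply; rewrite /M (le_trans (ler_norm _))// lerDl.
have c0 : 0 < e * alpha / (2 * M) by rewrite divr_gt0 ?mulr_gt0.
have [d d0 Hd] := powR_root c0.
have key a b : 0 <= a <= b -> b <= T -> b - a <= d -> `|abel h b - abel h a| <= e.
  move=> ab bT bad; have /andP[a0 leab] := ab.
  apply: (le_trans (@abel_holder _ _ alpha01 _ M _ _ lh ab _)).
    by move=> s /andP[s0 sb]; apply: HM; rewrite s0 (le_trans sb).
  have -> : e = 2 * M * (d `^ alpha / alpha).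
    by rewrite Hd; field; rewrite !gt_eqF.
  rewrite ler_pM2l ?mulr_gt0// ler_pM2r ?invr_gt0//.
  by apply: ge0_ler_powR; rewrite ?nnegrE ?subr_ge0// ltW.
near=> s.
have ts : `|t - s| <= d by near: s; exact: cvgr_dist_le.
have := le_trans (clamp_lipschitz T t s) ts.
have /andP[? ?] := clamp_itv t T0; have /andP[? ?] := clamp_itv s T0.
have [le|/ltW le] := leP (clamp T t) (clamp T s); rewrite ler_norml => /andP[? ?].
  rewrite distrC; apply: key; lra.
by apply: key; lra.
Unshelve. all: by end_near. Qed.

Lemma Rintegral_expR lam a : 0 < lam -> 0 < a ->
  \int[mu]_(s in `[0, a]) expR (lam * s) = (expR (lam * a) - 1) / lam.
Proof.
move=> l0 a0; rewrite /Rintegral.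
have D (x : R) : is_derive x 1 (fun s => expR (lam * s) / lam) (expR (lam * x)).
  have d1 : is_derive x 1 (fun s : R => lam * s) lam.
    have := @is_deriveZ R R R id lam x 1 1 (is_derive_id x 1).
    rewrite (_ : lam \*: id = (fun s : R => lam * s))//.
    by move=> H; apply: is_derive_eq H _; rewrite /GRing.scale/= mulr1.
  have d2 := @is_derive1_comp R expR (fun s => lam * s) x _ _ (is_derive_expR _) d1.
  have := @is_deriveZ R R R _ lam^-1 x 1 _ d2.
  rewrite (_ : (lam^-1 \*: (expR \o _)) = (fun s => expR (lam * s) / lam)); last first.
    by apply/funext => s; rewrite mulrC.
  by move=> H; apply: is_derive_eq H _; rewrite /GRing.scale/=; field; rewrite gt_eqF.
have C (f df : R -> R) (x : R) : is_derive x 1 f (df x) -> {for x, continuous f}.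
  by move=> [? _]; apply/differentiable_continuous/derivable1_diffP.
rewrite (@continuous_FTC2 _ _ (fun s => expR (lam * s) / lam))//.
- by rewrite -EFinB/= mulr0 expR0 -mulrBl.
- apply: continuous_subspaceT => x; apply: continuous_comp; last exact: continuous_expR.
  by apply: continuousM; [exact: cst_continuous | exact: id].
- split.
  + by move=> x _; have [] := D x.
  + by apply: cvg_at_right_filter; exact: (C _ (fun x : R => expR (lam * x)) _ (D _)).
  + by apply: cvg_at_left_filter; exact: (C _ (fun x : R => expR (lam * x)) _ (D _)).
- by move=> x _; rewrite derive1E; have [_ ->] := D x.
Qed.

Lemma continuous_expRM lam : continuous (fun s : R => expR (lam * s)).
Proof.
move=> s; apply: continuous_comp; last exact: continuous_expR.
by apply: continuousM; [exact: cst_continuous | exact: id].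
Qed.

(* The kernel mass near the diagonal is small, away from it the exponential decays. *)
Lemma abel_exp_contraction Lam : 0 <= Lam -> exists2 lam, 0 < lam &
  forall t, 0 <= t -> Lam * abel (fun s => expR (lam * s)) t <= 2^-1 * expR (lam * t).
Proof.
move=> L0.
have L4 : 0 < 4 * (Lam + 1) by lra.
(* Two contributions of [1 / (4 * (Lam + 1))] each: the kernel mass of a window of length [d] ending
   at [t], and [D / lam] from the exponential before that window, where the kernel is at most [D].
   Using [Lam + 1] also covers [Lam = 0]. *)
have [d d0 Hd] := @powR_root (alpha / (4 * (Lam + 1))) (divr_gt0 alpha_gt0 L4).
pose D := d `^ (alpha - 1); have D0 : 0 < D by exact: powR_gt0.
exists (4 * (Lam + 1) * D); first exact: mulr_gt0.
move=> t t0; set lam := _ * D.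
have lam0 : 0 < lam by exact: mulr_gt0.
have le : lbm (fun s => expR (lam * s)) by apply: lbm_continuous; exact: continuous_expRM.
pose a := Num.max 0 (t - d).
have a0t : 0 <= a <= t by rewrite /a; case: (leP 0 (t - d)) => ?; lra.
have /andP[a0 at_] := a0t.
have E0 : 0 < expR (lam * t) by exact: expR_gt0.
have B1 : \int[mu]_(s in `[0, a]) (ker t s * expR (lam * s)) <= D * (expR (lam * t) / lam).
  have [->|an0] := eqVneq a 0.
    by rewrite set_itv1 Rintegral_set1 mulr_ge0 ?divr_ge0// ltW.
  have ap : 0 < a by rewrite lt_neqAle eq_sym an0.
  have ad : a = t - d by move: ap; rewrite /a; case: (leP 0 (t - d)) => ?; lra.
  have ie : mu.-integrable `[0, a] (EFin \o (fun s => expR (lam * s))).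
    apply: continuous_compact_integrable; first exact: segment_compact.
    by apply: continuous_subspaceT; exact: continuous_expRM.
  apply: (@le_trans _ _ (\int[mu]_(s in `[0, a]) (D * expR (lam * s)))).
    apply: le_Rintegral => //.
    - exact: abel_integrable.
    - exact: (integrableZl _ _ ie).
    - move=> s /=; rewrite in_itv/= => /andP[s0 sa].
      rewrite ler_pM2r ?expR_gt0//.
      have -> : D = ker (s + d) s by rewrite /abel_ker addrAC subrr add0r.
      by apply: ler_ker => //; lra.
  rewrite RintegralZl// Rintegral_expR// ler_pM2l// ler_pM2r ?invr_gt0//.
  have : expR (lam * a) <= expR (lam * t) by rewrite ler_expR ler_pM2l.
  lra.
have B2 : \int[mu]_(s in `[a, t]) (ker t s * expR (lam * s)) <=
    expR (lam * t) * (d `^ alpha / alpha).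
  apply: (@le_trans _ _ (expR (lam * t) * ((t - a) `^ alpha / alpha))).
    apply: le_trans (ler_norm _) _.
    apply: norm_Rintegral_ker_le => // s /andP[_ st].
    by rewrite ger0_norm ?expR_ge0// ler_expR ler_pM2l// ltW.
  rewrite ler_pM2l// ler_pM2r ?invr_gt0//.
  apply: ge0_ler_powR; rewrite ?nnegrE ?subr_ge0//; try exact: ltW.
  by rewrite /a; case: (leP 0 (t - d)) => ?; lra.
rewrite (abel_split alpha01 le a0t).
apply: (@le_trans _ _ (Lam * (D * (expR (lam * t) / lam) + expR (lam * t) * (d `^ alpha / alpha)))).
  by rewrite ler_wpM2l// lerD.
rewrite Hd.
have -> : Lam * (D * (expR (lam * t) / lam) +
    expR (lam * t) * (alpha / (4 * (Lam + 1)) / alpha)) =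
    2^-1 * (Lam / (Lam + 1)) * expR (lam * t).
  by rewrite /lam; field; rewrite !gt_eqF//; lra.
rewrite ler_pM2r// ler_piMr ?invr_ge0// ler_pdivrMr; lra.
Qed.

(** At a maximum point [c] of [|u t| * expR (- lam * t)], with maximum [m], the contraction turns
    the hypothesis into [m * expR (lam * c) <= A + m / 2 * expR (lam * c)], whence [m <= 2 * A]. One
    constant serves every shorter interval [[0, T']]. *)
Lemma abel_gronwall Lam T : 0 <= Lam -> 0 <= T -> exists2 C, 0 < C &
  forall u A T', continuous u -> 0 <= A -> 0 <= T' <= T ->
    (forall t, 0 <= t <= T' -> `|u t| <= A + Lam * abel (fun s => `|u s|) t) ->
  forall t, 0 <= t <= T' -> `|u t| <= C * A.
Proof.
move=> L0 T0; have [lam lam0 Hlam] := abel_exp_contraction L0.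
exists (2 * expR (lam * T)); first by rewrite mulr_gt0// expR_gt0.
move=> u A T' cu A0 /andP[T'0 T'T] Hu.
have cnu : continuous (fun t => `|u t|).
  by move=> t; apply: continuous_comp; [exact: cu | exact: norm_continuous].
have cw : {within `[0, T'], continuous (fun t => `|u t| * expR (- lam * t))}.
  apply: continuous_subspaceT => t; apply: cvgM; first exact: cnu.
  exact: continuous_expRM.
have [c cT Hc] := EVT_max T'0 cw.
set m := _ * _ in Hc.
have m0 : 0 <= m by rewrite mulr_ge0// expR_ge0.
have um s : 0 <= s <= T' -> `|u s| <= m * expR (lam * s).
  move=> sT; have := Hc s; rewrite in_itv/= => /(_ sT).
  by rewrite mulNr expRN ler_pdivrMr// expR_gt0.
rewrite in_itv/= in cT; have /andP[c0 cleT] := cT.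
have m2A : m <= 2 * A.
  have h1 : `|u c| <= A + m * (2^-1 * expR (lam * c)).
    apply: le_trans (Hu c cT) _; rewrite lerD2l.
    apply: (@le_trans _ _ (Lam * (m * abel (fun s => expR (lam * s)) c))).
      rewrite ler_wpM2l// -abelZ//; last by apply: lbm_continuous; exact: continuous_expRM.
      apply: le_abel => //.
      - exact: lbm_continuous.
      - by apply: lbmZ; apply: lbm_continuous; exact: continuous_expRM.
      - by move=> s /andP[s0 sc]; apply: um; rewrite s0 (le_trans (ltW sc)).
    by rewrite mulrCA ler_wpM2l// Hlam.
  have mE : `|u c| = m * expR (lam * c).
    by rewrite /m mulNr expRN divfK// gt_eqF// expR_gt0.
  have E1 : 1 <= expR (lam * c) by rewrite -expR0 ler_expR mulr_ge0// ltW.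
  rewrite mE in h1.
  have h2 : A <= A * expR (lam * c) by rewrite ler_peMr.
  have : m * expR (lam * c) <= 2 * A * expR (lam * c) by lra.
  by rewrite ler_pM2r// expR_gt0.
move=> t tT; apply: le_trans (um t tT) _.
have /andP[t0 tleT] := tT.
rewrite [leRHS]mulrAC; apply: ler_pM => //; try exact: expR_ge0.
by rewrite ler_expR ler_pM2l// (le_trans tleT).
Qed.

(** Picard iteration: [P] contracts by 1/2 in the sup norm weighted by [expR (lam * t)]. Clamping
    time makes each iterate continuous on the whole line; the residual of the limit is bounded by a
    multiple of [2^-1 ^+ n] for every [n]. *)
Lemma volterra_exists (G : R -> R -> R) (g0 : R -> R) Lam T : 0 <= Lam -> 0 <= T ->
  (forall x, continuous x -> continuous (fun t => G t (x t))) ->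
  (forall t (x y : R), `|G t x - G t y| <= Lam * `|x - y|) ->
  continuous g0 ->
  exists x, continuous x /\
    forall t, 0 <= t <= T -> x t = g0 t + abel (fun s => G s (x s)) t.
Proof.
move=> L0 T0 GC GL cg0.
have [lam lam0 Hlam] := abel_exp_contraction L0.
pose P x t := g0 (clamp T t) + abel (fun s => G s (x s)) (clamp T t).
have Pc x : continuous x -> continuous (P x).
  move=> cx t; apply: cvgD.
    by apply: continuous_comp; [exact: continuous_clamp | exact: cg0].
  by apply: continuous_abel => //; apply: lbm_continuous; exact: GC.
pose X n := iter n P (fun _ => 0).
have Xc n : continuous (X n).
  by elim: n => [|n IH]; [move=> t; exact: cst_continuous | exact: Pc].
have [M HM] := @continuous_bounded_itv R (X 1%N) 0 T (Xc 1%N).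
have M0 : 0 <= M by apply: le_trans (HM 0 _); rewrite ?normr_ge0// lexx.
have lE : lbm (fun s => expR (lam * s)) by apply: lbm_continuous; exact: continuous_expRM.
have lG x : continuous x -> lbm (fun s => G s (x s)).
  by move=> cx; apply: lbm_continuous; exact: GC.
have ctc t : clamp T (clamp T t) = clamp T t by rewrite clamp_id// clamp_itv.
have lipP (x y : R -> R) B : continuous x -> continuous y -> 0 <= B ->
    (forall s, 0 <= s <= T -> `|x s - y s| <= B * expR (lam * s)) ->
    forall t, `|P x t - P y t| <= B / 2 * expR (lam * clamp T t).
  move=> cx cy B0 xy t; rewrite /P opprD addrACA subrr add0r -abelB; [|exact: alpha01|exact: lG|exact: lG].
  have /andP[ct0 ctT] := clamp_itv t T0.
  apply: (@le_trans _ _ (abel (fun s => (Lam * B) * expR (lam * s)) (clamp T t))).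
    apply: le_norm_abel => //.
    - by apply: lbmB; exact: lG.
    - exact: lbmZ.
    - move=> s /andP[s0 st]; apply: le_trans (GL _ _ _) _.
      by rewrite -mulrA ler_wpM2l// xy// s0 (le_trans (ltW st)).
  rewrite abelZ// mulrAC mulrC -mulrA ler_wpM2l//.
  exact: Hlam.
have dX n t : `|X n.+1 t - X n t| <= M * 2^-1 ^+ n * expR (lam * clamp T t).
  elim: n t => [|n IH] t.
    rewrite expr0 mulr1 subr0.
    have -> : X 1%N t = X 1%N (clamp T t) by rewrite /X/= /P ctc.
    apply: le_trans (HM _ (clamp_itv t T0)) _; rewrite ler_peMr//.
    rewrite -expR0 ler_expR mulr_ge0 ?(ltW lam0)//.
    by case/andP: (clamp_itv t T0).
  apply: le_trans (@lipP (X n.+1) (X n) (M * 2^-1 ^+ n) _ _ _ _ t) _ => //.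
  - by rewrite mulr_ge0// exprn_ge0.
  - by move=> s sT; have := IH s; rewrite clamp_id.
  - by rewrite exprSr mulrA.
have EX t : exists l, forall n, `|l - X n t| <= 2 * (M * expR (lam * T)) * 2^-1 ^+ n.
  apply: geometric_limit => n; apply: le_trans (dX n t) _.
  rewrite mulrAC ler_wpM2r ?exprn_ge0// ler_wpM2l// ler_expR ler_pM2l//.
  by case/andP: (clamp_itv t T0).
pose x t := projT1 (cid (EX t)).
pose C := 2 * (M * expR (lam * T)).
have C0 : 0 <= C by rewrite /C !mulr_ge0// expR_ge0.
have xX t n : `|x t - X n t| <= C * 2^-1 ^+ n by exact: (projT2 (cid (EX t))).
have cx : continuous x.
  apply: uniform_limit_continuous_real => e e0.
  have [n Hn] : exists n : nat, C * 2^-1 ^+ n <= e.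
    apply: contrapT => /forallNP H.
    have : e = 0.
      apply: (@geometric_small _ _ C) => n; rewrite gtr0_norm//.
      by have /negP := H n; rewrite -ltNge => /ltW.
    by move=> e00; move: e0; rewrite e00 ltxx.
  by exists (X n); split => // t; apply: le_trans (xX t n) Hn.
exists x; split => // t tT.
apply/eqP; rewrite -subr_eq0; apply/eqP.
apply: (@geometric_small _ _ (C + C * expR (lam * T))) => n.
have -> : x t - (g0 t + abel (fun s => G s (x s)) t) =
  (x t - X n.+1 t) + (P (X n) t - P x t).
  by rewrite [X n.+1]/(P (X n)) addrA subrK /P clamp_id.
apply: le_trans (ler_normD _ _) _; rewrite mulrDl; apply: lerD.
  apply: le_trans (xX t n.+1) _; rewrite ler_wpM2l// exprS ler_piMl ?exprn_ge0//.
  by rewrite invf_le1// ler1n.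
apply: le_trans (@lipP (X n) x (C * 2^-1 ^+ n) _ _ _ _ t) _ => //.
- by rewrite mulr_ge0// exprn_ge0.
- move=> s /andP[s0 _]; rewrite distrC; apply: le_trans (xX s n) _.
  rewrite ler_peMr ?mulr_ge0 ?exprn_ge0//.
  by rewrite -expR0 ler_expR mulr_ge0// ltW.
- rewrite clamp_id//; have /andP[t0 tleT] := tT.
  have h : expR (lam * t) <= expR (lam * T) by rewrite ler_expR ler_pM2l.
  have q0 : 0 <= C * 2^-1 ^+ n by rewrite mulr_ge0// exprn_ge0.
  rewrite [leRHS]mulrAC; apply: ler_pM => //; try exact: expR_ge0.
    by rewrite divr_ge0.
  by rewrite ler_piMr// invf_le1// ler1n.
Qed.

End Volterra.

(** * Positivity of responses *)

Section Positivity.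
Context {R : realType} (alpha : R).
Hypothesis alpha01 : 0 < alpha < 1.
Notation mu := (@lebesgue_measure R).
Local Notation ker := (abel_ker alpha).
Local Notation abel := (abel alpha).
Implicit Types (h g u x z p : R -> R) (t c a b s M T lam : R).

Let alpha_gt0 : 0 < alpha. Proof. by case/andP: alpha01. Qed.
Let alpha_lt1 : alpha < 1. Proof. by case/andP: alpha01. Qed.

(** [t1] is the least element of the compact set where [z <= 0]; if [z t1] were negative, the
    intermediate value theorem would produce an earlier zero. *)
Lemma first_zero z a b t : continuous z -> a <= t <= b -> 0 < z a -> z t <= 0 ->
  exists t1, [/\ a < t1 <= b, z t1 = 0 & forall s, a <= s < t1 -> 0 < z s].
Proof.
move=> cz /andP[at_ tb] za zt.
pose S := `[a, b]%classic `&` [set s | z s <= 0].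
have cS : compact S.
  apply: compact_closedI; first exact: segment_compact.
  rewrite (_ : [set s | _] = z @^-1` [set r | r <= 0])//.
  apply: closed_comp; last exact: closed_le.
  by move=> s _; exact: cz.
have S0 : S !=set0 by exists t; split => //=; rewrite in_itv/= at_.
have cidS : {within S, continuous (id : R -> R)}.
  by apply: continuous_subspaceT => r; exact: cvg_id.
have [t1 t1S Ht1] := compact_EVT_min S0 cS cidS.
move: t1S; rewrite inE => -[/=]; rewrite in_itv/= => /andP[at1 t1b] zt1.
have lt : a < t1.
  by rewrite lt_neqAle at1 andbT; apply/eqP => e; move: zt1; rewrite -e leNgt za.
have pos s : a <= s < t1 -> 0 < z s.
  move=> /andP[as_ st1]; rewrite ltNge; apply/negP => zs.
  have : s \in S by rewrite inE; split => //=; rewrite in_itv/= as_ (le_trans (ltW st1)).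
  by move/Ht1; rewrite leNgt st1.
exists t1; split => //; first by rewrite lt.
apply/eqP; rewrite eq_le zt1/=.
have cw : {within `[a, t1], continuous z} by apply: continuous_subspaceT.
have /(IVT (ltW lt) cw)[c] : Num.min (z a) (z t1) <= 0 <= Num.max (z a) (z t1).
  by rewrite ge_min zt1 orbT le_max (ltW za).
rewrite in_itv/= => /andP[ac ct1] zc.
rewrite leNgt; apply/negP => zneg.
have ct : c < t1.
  by rewrite lt_neqAle ct1 andbT; apply/eqP => e; move: zneg; rewrite -e zc ltxx.
by have := pos c; rewrite ac ct zc ltxx => /(_ isT).
Qed.

Lemma ker_gt0 t s : s < t -> 0 < ker t s.
Proof. by move=> st; apply: powR_gt0; rewrite subr_gt0. Qed.

(** The ratio [ker t' s / ker t s] decreases in [s]: older memory fades relatively less. After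
    inverting powers this is [(t' - s) * (t - s') <= (t' - s') * (t - s)], and the two sides differ
    by [(t' - t) * (s' - s)]. *)
Lemma ker_ratio s s' t t' : s <= s' -> s' < t -> t <= t' ->
  ker t' s' * ker t s <= ker t' s * ker t s'.
Proof.
move=> ss s't tt.
have E (x : R) : x `^ (alpha - 1) = (x `^ (1 - alpha))^-1 by rewrite -powRN opprB.
rewrite /abel_ker -!powRM ?subr_ge0; try lra.
rewrite !E lef_pV2 ?posrE ?powR_gt0 ?mulr_gt0 ?subr_gt0//; try lra.
apply: ge0_ler_powR; rewrite ?nnegrE ?mulr_ge0 ?subr_ge0//; try lra; first exact: ltW.
rewrite -subr_ge0 (_ : _ - _ = (t' - t) * (s' - s)); last by ring.
by rewrite mulr_ge0// subr_ge0.
Qed.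

Lemma ker_half d t t' : d < t -> t <= t' -> t' - d <= 2 * (t - d) ->
  2^-1 * ker t d <= ker t' d.
Proof.
move=> dt tt' h.
have E (x : R) : x `^ (alpha - 1) = (x `^ (1 - alpha))^-1 by rewrite -powRN opprB.
have p : 0 < t - d by rewrite subr_gt0.
have p' : 0 < t' - d by rewrite subr_gt0 (lt_le_trans dt).
rewrite /abel_ker !E -invfM lef_pV2 ?posrE ?mulr_gt0 ?powR_gt0//.
apply: (@le_trans _ _ ((2 * (t - d)) `^ (1 - alpha))).
  by apply: ge0_ler_powR; rewrite ?nnegrE ?subr_ge0//; try lra; exact: ltW.
rewrite powRM//; last exact: ltW.
rewrite ler_pM2r ?powR_gt0// -[leRHS]powRr1// ler_powR ?ler1n// lerBlDr lerDl.
exact: ltW.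
Qed.

(* Take [t1] the first zero of [z] after [d] and [t < t1] a maximum point of [z]
   on a short interval ending at [t1]. With [rho := ker t1 d / ker t d] the kernel
   ratio is monotone, so that passing from [t] to [t1] costs at most a factor [rho]
   on the memory of [0, t] and at most [z t / 4] on [t, t1]. *)
Lemma positivity_after z h (g0 lam d T : R) : 0 <= g0 -> 0 <= lam -> 0 <= d ->
  continuous z -> lbm h ->
  (forall t, 0 <= t <= T -> z t = g0 + abel h t) ->
  (forall s, 0 <= s < d -> 0 <= h s) ->
  (forall s, d <= s <= T -> h s = - lam * z s) ->
  0 < z d -> forall t, d <= t <= T -> 0 < z t.
Proof.
move=> g00 lam0 d0 cz lh zE h0 hE zd t' t'T; rewrite ltNge; apply/negP => zt'.
have [t1 [/andP[dt1 t1T] zt1 zpos]] := first_zero cz t'T zd zt'.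
have L4 : 0 < 4 * (lam + 1) by lra.
have [de de0 Hde] := powR_root alpha01 (divr_gt0 alpha_gt0 L4).
(* The midpoint ensures [t1 - d <= 2 * (t - d)], hence [rho >= 1/2]; staying within [de] of [t1]
   keeps the kernel mass on [[t, t1]] below [1 / (4 * (lam + 1))]. *)
pose t0 := Num.max ((d + t1) / 2) (t1 - de).
have t0P : [/\ t0 < t1, (d + t1) / 2 <= t0 & t1 - de <= t0].
  by rewrite /t0; case: (leP ((d + t1) / 2) (t1 - de)) => ?; split; lra.
have [t01 t0d t0e] := t0P.
have cw : {within `[t0, t1], continuous z} by exact: continuous_subspaceT.
have [t] := EVT_max (ltW t01) cw.
rewrite in_itv/= => /andP[t0t tt1] zmax.
have zt0 : 0 < z t0 by apply: zpos; lra.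
have zt : 0 < z t by apply: lt_le_trans zt0 (zmax _ _); rewrite in_itv/= lexx ltW.
have lt1 : t < t1.
  by rewrite lt_neqAle tt1 andbT; apply/eqP => e; move: zt; rewrite e zt1 ltxx.
have dt : d < t by lra.
have ktd : 0 < ker t d by exact: ker_gt0.
pose rho := ker t1 d / ker t d.
have rho1 : rho <= 1 by rewrite ler_pdivrMr// mul1r; exact: ler_ker.
have rho2 : 2^-1 <= rho by rewrite ler_pdivlMr//; apply: ker_half => //; lra.
have t0t1 : 0 <= t <= t1 by lra.
(* Before [d] the input is nonnegative and the ratio [ker t1 s / ker t s] is at least [rho]; after
   [d] the input is nonpositive and the ratio is at most [rho]. Both cases give the same
   inequality. *)
have B1 : rho * abel h t <= \int[mu]_(s in `[0, t]) (ker t1 s * h s).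
  rewrite /abel -RintegralZl//; last by apply: abel_integrable => //; lra.
  apply: le_Rintegral_co.
  - apply: (@integrableZl _ _ _ mu `[0, t] _ rho (fun s => (ker t s * h s)%:E)) => //.
    by apply: abel_integrable => //; lra.
  - exact: abel_integrable.
  - move=> s /andP[s0 st]; rewrite mulrA; have [sd|ds] := ltP s d.
      apply: ler_wpM2r; first by apply: h0; rewrite s0.
      by rewrite mulrAC ler_pdivrMr//; apply: ker_ratio => //; exact: ltW.
    have zs : 0 < z s by apply: zpos; rewrite ds (lt_trans st).
    rewrite hE; last by lra.
    rewrite !(mulrC _ (_ * z s)); apply: ler_wnM2l.
      by rewrite mulNr oppr_le0 mulr_ge0// ltW.
    by rewrite mulrAC ler_pdivlMr//; apply: ker_ratio => //; exact: ltW.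
have B2 : - (z t / 4) <= \int[mu]_(s in `[t, t1]) (ker t1 s * h s).
  apply: (@le_trans _ _ (- (lam * z t) * ((t1 - t) `^ alpha / alpha))); last first.
    apply: Rintegral_ker_ge => // s /andP[ts st].
    rewrite hE; last by lra.
    rewrite -mulNr; apply: ler_wnM2l; first by rewrite oppr_le0.
    by apply: zmax; rewrite in_itv/=; lra.
  have q : (t1 - t) `^ alpha / alpha <= (4 * (lam + 1))^-1.
    apply: (@le_trans _ _ (de `^ alpha / alpha)).
      rewrite ler_pM2r ?invr_gt0//.
      by apply: ge0_ler_powR; rewrite ?nnegrE ?subr_ge0//; do ?exact: ltW; lra.
    by rewrite Hde mulrAC divff ?gt_eqF// mul1r.
  rewrite mulNr lerN2 mulrAC.
  rewrite [leRHS]mulrC ler_pM2r//.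
  apply: (@le_trans _ _ (lam * (4 * (lam + 1))^-1)); first by rewrite ler_wpM2l.
  by rewrite ler_pdivrMr//; lra.
have t1T0 : 0 <= t1 <= T by apply/andP; split => //; apply: ltW; apply: le_lt_trans dt1.
have tT0 : 0 <= t <= T by case/andP: t0t1 => -> /le_trans ->.
(* The contradiction: [0 = z t1 >= g0 + rho * (z t - g0) - z t / 4 >= z t / 4 > 0]. *)
have H1 := zE t1 t1T0; rewrite zt1 (abel_split alpha01 lh t0t1) in H1.
have zEt : abel h t = z t - g0 by rewrite (zE t tT0) addrAC subrr add0r.
rewrite zEt in B1.
have r1 : 2^-1 * z t <= rho * z t by rewrite ler_pM2r.
have r2 : rho * g0 <= g0 by rewrite ler_piMl.
rewrite mulrBr in B1.
lra.
Qed.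

(** [e] is the Mittag-Leffler function $E_\alpha(-\lambda\Gamma(\alpha)t^\alpha)$, known here only
    through its equation. Its positivity is [positivity_after] with [d = 0] and [g0 = 1]. *)
Lemma resolvent_exists lam T : 0 <= lam -> 0 <= T ->
  exists e : R -> R, [/\ continuous e,
    forall t, 0 <= t <= T -> e t = 1 - lam * abel e t &
    forall t, 0 <= t <= T -> 0 < e t].
Proof.
move=> l0 T0.
have [|||e [ce eE]] := @volterra_exists R alpha alpha01 (fun _ (v : R) => - lam * v) (fun _ => 1) lam T l0 T0.
- by move=> x cx t; apply: cvgM; [exact: cst_continuous | exact: cx].
- by move=> t x y /=; rewrite -mulrBr normrM normrN (ger0_norm l0).
- by move=> t; exact: cst_continuous.
have le := lbm_continuous ce.
exists e; split => //.
  by move=> t tT; rewrite eE// abelZ// mulNr.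
have lh : lbm (fun s => - lam * e s) by exact: lbmZ.
apply: (@positivity_after e (fun s => - lam * e s) 1 lam 0 T) => //.
- by move=> s; lra.
- by rewrite eE ?lexx// abel0// addr0.
Qed.

Section Comparison.
Variables (lam T : R).
Hypotheses (lam0 : 0 < lam) (T0 : 0 <= T).

(** By Gronwall [w] vanishes before the slice and satisfies [lam * |w| <= eta / 2] up to its end, so
    there the net input is at least [eta / 2]. Past the slice only the feedback [- lam * w] remains
    and [positivity_after] takes over. The Gronwall constant is a parameter, so that [de] can be
    fixed for all slices at once. *)
Lemma response_ge0_step w p (eta a de M C : R) : 0 < eta -> 0 <= a -> 0 < de ->
  continuous w -> continuous p ->
  (forall s, 0 <= s <= T -> eta <= p s <= M) ->
  (forall u A T', continuous u -> 0 <= A -> 0 <= T' <= T ->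
    (forall t, 0 <= t <= T' -> `|u t| <= A + lam * abel (fun s => `|u s|) t) ->
    forall t, 0 <= t <= T' -> `|u t| <= C * A) ->
  lam * (C * (M * (de `^ alpha / alpha))) <= eta / 2 ->
  (forall t, 0 <= t <= T ->
    w t = abel (fun s => p s * \1_(`[a, a + de[) s - lam * w s) t) ->
  forall t, 0 <= t <= T -> 0 <= w t.
Proof.
move=> eta0 a0 de0 cw cp pB gron small wE.
pose b := a + de.
pose q s := p s * \1_(`[a, b[) s.
have lq : lbm q by apply: lbmM; [exact: lbm_continuous | exact: lbm_indic].
have lw := lbm_continuous cw.
have lnw : lbm (fun s => `|w s|) by exact: lbm_norm.
have lh : lbm (fun s => q s - lam * w s) by apply: lbmB => //; exact: lbmZ.
have q_lt s : s < a -> q s = 0.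
  by move=> sa; rewrite /q indicE memNset ?mulr0//=; rewrite in_itv/=; lra.
have q_ge s : b <= s -> q s = 0.
  by move=> bs; rewrite /q indicE memNset ?mulr0//=; rewrite in_itv/=; lra.
have q_in s : a <= s < b -> q s = p s.
  by move=> sab; rewrite /q indicE mem_set ?mulr1//=; rewrite in_itv.
have M0 : 0 <= M by have := pB 0; rewrite lexx T0 => /(_ isT) /andP[]; lra.
have wN A T' : 0 <= T' <= T -> (forall t, 0 <= t <= T' -> `|abel q t| <= A) ->
    forall t, 0 <= t <= T' -> `|w t| <= A + lam * abel (fun s => `|w s|) t.
  move=> T'T HA t tT'; rewrite wE; last by lra.
  rewrite -/b -/(q _) abelB//; last exact: lbmZ.
  apply: le_trans (ler_normB _ _) _; apply: lerD; first exact: HA.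
  rewrite abelZ// normrM gtr0_norm// ler_pM2l//.
  by apply: le_norm_abel.
have w0 t : 0 <= t <= T -> t <= a -> w t = 0.
  move=> tT ta; apply/eqP; rewrite -normr_le0.
  have tT' : 0 <= t <= t by rewrite lexx andbT; case/andP: tT.
  have := gron w 0 t cw (lexx 0) tT (wN 0 t tT _) t tT'; rewrite mulr0; apply.
  move=> r /andP[r0 rt]; rewrite (_ : abel q r = abel (fun=> 0) r).
    by rewrite abel_cst// mul0r normr0.
  apply: eq_abel => //; first exact: lbm_cst.
  by move=> s /andP[_ sr]; apply: q_lt; lra.
have wsmall t : 0 <= t <= T -> t <= b -> lam * `|w t| <= eta / 2.
  move=> tT tb; apply: le_trans small; rewrite ler_pM2l//.
  have A0 : 0 <= M * (de `^ alpha / alpha).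
    by rewrite mulr_ge0// divr_ge0 ?powR_ge0// ltW.
  have tT' : 0 <= t <= t by rewrite lexx andbT; case/andP: tT.
  apply: (gron w _ t cw A0 tT (wN _ t tT _) t tT').
  move=> r /andP[r0 rt]; have [ra|ar] := leP r a.
    rewrite (_ : abel q r = abel (fun=> 0) r).
      by rewrite abel_cst// mul0r normr0.
    apply: eq_abel => //; first exact: lbm_cst.
    by move=> s /andP[_ sr]; apply: q_lt; lra.
  rewrite (@abel_split _ _ alpha01 _ a)//; last by lra.
  rewrite (_ : \int[mu]_(s in `[0, a]) (ker r s * q s) = 0); last first.
    (* The endpoint [a] belongs to the slice, so [q] vanishes only on [[0, a[]. *)
    rewrite -(Rintegral_itv_bndo_bndc); last first.
      apply: (@integrableS _ _ _ mu `[0, r]) => //; last exact: abel_integrable.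
      by apply: subset_itv; rewrite bnd_simp//; exact: ltW.
    rewrite (@eq_Rintegral _ _ _ _ _ (fun=> 0)) ?Rintegral_cst ?mul0r//.
    by move=> s; rewrite inE/= in_itv/= => /andP[_ sa]; rewrite q_lt// mulr0.
  rewrite add0r.
  apply: (@le_trans _ _ (M * ((r - a) `^ alpha / alpha))).
    apply: norm_Rintegral_ker_le => //; first by lra.
    move=> s /andP[as_ sr]; rewrite q_in; last by lra.
    have /pB : 0 <= s <= T by lra.
    by rewrite ler_norml; lra.
  rewrite ler_wpM2l// ler_pM2r ?invr_gt0//.
  by apply: ge0_ler_powR; rewrite ?nnegrE ?subr_ge0//; do ?exact: ltW; rewrite /b in tb; lra.
have hge s : 0 <= s <= T -> a <= s < b -> eta / 2 <= q s - lam * w s.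
  move=> sT sab; rewrite q_in//.
  have /andP[_ /ltW sb] := sab.
  have := wsmall s sT sb; have /andP[p1 _] := pB s sT.
  have : lam * w s <= lam * `|w s| by rewrite ler_pM2l// ler_norm.
  lra.
have h0 s : 0 <= s < b -> s <= T -> 0 <= q s - lam * w s.
  move=> /andP[s0 sb] sT; have sT' : 0 <= s <= T by lra.
  have [sa|as_] := ltP s a; first by rewrite q_lt// w0//; [lra | exact: ltW].
  by apply: le_trans (hge s sT' _); rewrite ?as_//; lra.
have wb t : 0 <= t <= T -> t <= b -> 0 <= w t.
  move=> tT tb; rewrite wE//.
  have -> : 0 = abel (fun=> 0) t by rewrite abel_cst ?mul0r//; lra.
  apply: le_abel => //; first exact: lbm_cst.
  by move=> s /andP[s0 st]; apply: h0; lra.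
move=> t tT; have [/(wb _ tT)//|bt] := leP t b.
apply/ltW; apply: (@positivity_after w (fun s => q s - lam * w s) 0 lam b T) => //.
- exact: ltW.
- by rewrite /b; lra.
- by move=> r rT; rewrite add0r wE.
- by move=> s /andP[s0 sb]; apply: h0; rewrite ?s0//; lra.
- by move=> s /andP[bs _]; rewrite q_ge// sub0r mulNr.
- have bT : 0 <= b <= T by rewrite /b in bt *; lra.
  rewrite wE// -/(q _) (@abel_split _ _ alpha01 _ a)//; last by rewrite /b; lra.
  apply: ltr_wpDl.
    apply: Rintegral_ge0 => s /=; rewrite in_itv/= => /andP[s0 sa].
    by apply: mulr_ge0; [exact: ker_ge0 | apply: h0; rewrite /b in bt bT *; lra].
  apply: lt_le_trans (@Rintegral_ker_ge _ _ alpha01 _ (eta / 2) a b _ _ _) => //.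
  + by rewrite mulr_gt0// ?divr_gt0// powR_gt0// /b; lra.
  + by rewrite /b; lra.
  + by move=> s sab; apply: hge; lra.
- by rewrite (ltW bt); case/andP: tT.
Qed.

End Comparison.
End Positivity.

(** * Comparison, separation and prescribed values for scalar equations *)

Section ScalarFlow.
Context {R : realType} (alpha : R).
Hypothesis alpha01 : 0 < alpha < 1.
Local Notation abel := (abel alpha).
Implicit Types (h g u x y z p : R -> R) (t c a b s M T lam : R).

Let alpha_gt0 : 0 < alpha. Proof. by case/andP: alpha01. Qed.

Lemma continuousZ_real c x : continuous x -> continuous (fun t => c * x t).
Proof. by move=> cx t; apply: cvgM; [exact: cvg_cst | exact: cx]. Qed.

Lemma continuousD_real x y : continuous x -> continuous y -> continuous (fun t => x t + y t).
Proof. by move=> cx cy t; apply: cvgD; [exact: cx | exact: cy]. Qed.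

Lemma continuousB_real x y : continuous x -> continuous y -> continuous (fun t => x t - y t).
Proof. by move=> cx cy t; apply: cvgB; [exact: cx | exact: cy]. Qed.

(** Superposition: [Z] for the cutoff at [n.+1] minus [Z] for the cutoff at [n] is the response to
    one slice. Finitely many slices cover [[0, T]], and there Gronwall identifies the last [Z] with
    [z]. *)
Lemma response_ge0_pos z p (lam T eta : R) : 0 < lam -> 0 <= T -> 0 < eta ->
  continuous z -> continuous p -> (forall s, 0 <= s <= T -> eta <= p s) ->
  (forall t, 0 <= t <= T -> z t = abel (fun s => p s - lam * z s) t) ->
  forall t, 0 <= t <= T -> 0 <= z t.
Proof.
move=> lam0 T0 eta0 cz cp petap zE.
have [M1 HM1] := @continuous_bounded_itv R p 0 T cp.
pose M : R := `|M1| + 1.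
have M0 : 0 < M by rewrite ltr_wpDl.
have pB s : 0 <= s <= T -> eta <= p s <= M.
  move=> sT; rewrite petap//=; apply: le_trans (ler_norm _) _.
  apply: le_trans (HM1 s sT) _; apply: le_trans (ler_norm _) _.
  by rewrite /M lerDl.
have [C C0 gron] := abel_gronwall alpha01 (ltW lam0) T0.
have c0 : 0 < eta * alpha / (2 * (lam * (C * M))) by rewrite divr_gt0 ?mulr_gt0.
have [de de0 Hde] := powR_root alpha01 c0.
have small : lam * (C * (M * (de `^ alpha / alpha))) <= eta / 2.
  rewrite Hde le_eqVlt; apply/orP; left; apply/eqP; field.
  by rewrite !gt_eqF.
(* Open on the right, so that consecutive cutoffs differ exactly by the half-open slice of
   [response_ge0_step]. *)
pose ind n := \1_(`]-oo, (n%:R * de)[%classic) : R -> R.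
have indE n s : ind n s = if s < n%:R * de then 1 else 0.
  rewrite /ind indicE; case: ltP => sn.
    by rewrite mem_set//=; rewrite in_itv.
  by rewrite memNset//=; rewrite in_itv/=; apply/negP; rewrite -leNgt.
have lind n : lbm (fun s => p s * ind n s).
  by apply: lbmM; [exact: lbm_continuous | exact: lbm_indic].
have lZ (Z : R -> R) : continuous Z -> lbm (fun s => lam * Z s).
  by move=> cZ; apply: lbmZ; exact: lbm_continuous.
have stepZ n : exists Z, [/\ continuous Z,
    forall t, 0 <= t <= T -> Z t = abel (fun s => p s * ind n s - lam * Z s) t &
    forall t, 0 <= t <= T -> 0 <= Z t].
  elim: n => [|n [Z [cZ ZE Z0]]].
    exists (fun=> 0); split => //; first by move=> t; exact: cst_continuous.
    move=> t tT; rewrite (_ : abel _ t = abel (fun=> 0) t).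
      by rewrite abel_cst ?mul0r//; case/andP: tT.
    apply: eq_abel => //; [|exact: lbm_cst|].
      by apply: lbmB => //; apply: lbm_cst.
    move=> s /andP[s0 _]; rewrite indE mul0r ltNge s0/=.
    by rewrite !mulr0 subr0.
  (* The cut-off input jumps and cannot be part of [G]; it enters as forcing through its Abel
     integral, which is continuous. *)
  have [|||Z' [cZ' Z'E]] := @volterra_exists R alpha alpha01 (fun _ (v : R) => - lam * v)
     (fun t => abel (fun s => p s * ind n.+1 s) (clamp T t)) lam T (ltW lam0) T0.
  - by move=> x cx; exact: continuousZ_real.
  - by move=> t x y; rewrite /= -mulrBr normrM normrN (gtr0_norm lam0).
  - exact: continuous_abel.
  have Z'E2 t : 0 <= t <= T -> Z' t = abel (fun s => p s * ind n.+1 s - lam * Z' s) t.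
    move=> tT; rewrite Z'E// clamp_id// -abelD//; last first.
      by apply: lbmZ; exact: lbm_continuous.
    by congr abel; apply/funext => s; rewrite mulNr.
  exists Z'; split => // t tT.
  rewrite -(subrK (Z t) (Z' t)) addr_ge0 ?Z0//.
  have a0 : 0 <= n%:R * de by rewrite mulr_ge0// ltW.
  apply: (@response_ge0_step R alpha alpha01 lam T lam0 T0 (fun s => Z' s - Z s) p eta (n%:R * de)
    de M C) => //; first exact: continuousB_real.
  move=> r rT; rewrite Z'E2// ZE// -abelB//; try by apply: lbmB => //; exact: lZ.
  congr abel; apply/funext => s; rewrite !indE indicE.
  have -> : (s \in `[n%:R * de, n%:R * de + de[%classic) =
     (n%:R * de <= s < n%:R * de + de) by rewrite mem_setE in_itv.
  have -> : n.+1%:R * de = n%:R * de + de by rewrite -natr1 mulrDl mul1r.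
  case: (ltP s (n%:R * de)) => h1; case: (ltP s (n%:R * de + de)) => h2 /=; first [ring | exfalso; lra].
pose n := (Num.truncn (T / de)).+1.
have Tn : T < n%:R * de by rewrite -ltr_pdivrMr//; exact: truncnS_gt.
have [Z [cZ ZE Z0]] := stepZ n.
move=> t tT; suff -> : z t = Z t by exact: Z0.
apply/eqP; rewrite -subr_eq0 -normr_le0.
have cd := continuousB_real cz cZ.
have TT : 0 <= T <= T by rewrite T0 lexx.
have := gron (fun s => z s - Z s) 0 T cd (lexx 0) TT _ t tT.
rewrite mulr0; apply => r rT; rewrite add0r zE// ZE//.
rewrite (_ : abel (fun s => p s * ind n s - lam * Z s) r =
             abel (fun s => p s - lam * Z s) r); last first.
  apply: eq_abel => //.
  - by apply: lbmB => //; exact: lZ.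
  - by apply: lbmB; [exact: lbm_continuous|exact: lZ].
  - move=> s /andP[s0 sr]; rewrite indE ifT ?mulr1//.
    by apply: lt_trans sr _; apply: le_lt_trans Tn; case/andP: rT.
rewrite -abelB//; try by apply: lbmB; [exact: lbm_continuous|exact: lZ].
rewrite -abelZ//; last by apply: lbm_norm; exact: lbm_continuous.
apply: le_norm_abel => //.
- by apply: lbmB; (apply: lbmB; [exact: lbm_continuous|exact: lZ]).
- by apply: lbmZ; apply: lbm_norm; exact: lbm_continuous.
- move=> s _; rewrite (_ : _ - _ = - lam * (z s - Z s)); last by ring.
  by rewrite normrM normrN (gtr0_norm lam0).
Qed.

(* Adding [eta] to [p] adds [eta * (1 - e) / lam] to the response. *)
Lemma response_ge0 z p (lam T : R) : 0 < lam -> 0 <= T ->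
  continuous z -> continuous p -> (forall s, 0 <= s <= T -> 0 <= p s) ->
  (forall t, 0 <= t <= T -> z t = abel (fun s => p s - lam * z s) t) ->
  forall t, 0 <= t <= T -> 0 <= z t.
Proof.
move=> lam0 T0 cz cp p0 zE t tT.
have [e [ce eE epos]] := resolvent_exists alpha01 (ltW lam0) T0.
have cv : continuous (fun s => lam^-1 * (1 - e s)).
  by apply: continuousZ_real; apply: continuousB_real => // s; exact: cst_continuous.
have key eta : 0 < eta -> 0 <= z t + eta * (lam^-1 * (1 - e t)).
  move=> eta0.
  apply: (@response_ge0_pos (fun s => z s + eta * (lam^-1 * (1 - e s)))
    (fun s => p s + eta) lam T eta) => //.
  - by apply: continuousD_real => //; exact: continuousZ_real.
  - by apply: continuousD_real => // s; exact: cst_continuous.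
  - by move=> s /p0; rewrite lerDr.
  move=> r rT; rewrite zE//.
  have -> : 1 - e r = lam * abel e r by rewrite eE// opprB addrCA subrr addr0.
  rewrite mulKf ?gt_eqF// -abelZ//; last exact: lbm_continuous.
  have l1 : lbm (fun s => p s - lam * z s).
    by apply: lbmB; [exact: lbm_continuous|apply: lbmZ; exact: lbm_continuous].
  rewrite -abelD//; last by apply: lbmZ; exact: lbm_continuous.
  by congr abel; apply/funext => s; field; rewrite gt_eqF.
have e1 := epos t tT.
rewrite leNgt; apply/negP => zneg.
(* If the coefficient [v] of [eta] is not positive, [eta = 1] already contradicts [z t < 0];
   otherwise [eta] is chosen so that the added term is [- z t / 2], leaving [z t / 2]. *)
have [v0|v0] := leP (lam^-1 * (1 - e t)) 0.
  have := key 1 ltr01; rewrite mul1r; lra.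
set v := lam^-1 * _ in v0 key.
have v2 : 0 < 2 * v by rewrite mulr_gt0.
have := key (- z t / (2 * v)) (divr_gt0 _ v2); rewrite oppr_gt0 => /(_ zneg).
have -> : - z t / (2 * v) * v = - z t / 2 by field; rewrite gt_eqF.
lra.
Qed.

Lemma comparison u h e (lam T : R) : 0 < lam -> 0 <= T ->
  continuous u -> continuous h -> continuous e ->
  (forall t, 0 <= t <= T -> e t = 1 - lam * abel e t) ->
  (forall t, 0 <= t <= T -> 0 < e t) ->
  (forall t, 0 <= t <= T -> u t = u 0 + abel h t) ->
  (forall s, 0 <= s <= T -> `|h s| <= lam * `|u s|) ->
  0 < u 0 -> forall t, 0 <= t <= T -> u 0 * e t <= u t.
Proof.
move=> lam0 T0 cu ch ce eE epos uE hu u0.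
have key T' : 0 <= T' <= T -> (forall s, 0 <= s <= T' -> 0 <= u s) ->
    u 0 * e T' <= u T'.
  move=> T'T upos; rewrite -subr_ge0.
  have T'0 : 0 <= T' by case/andP: T'T.
  apply: (@response_ge0 (fun s => u s - u 0 * e s) (fun s => h s + lam * u s) lam T') => //.
  - by apply: continuousB_real => //; exact: continuousZ_real.
  - by apply: continuousD_real => //; exact: continuousZ_real.
  - move=> s sT'; have sT : 0 <= s <= T by lra.
    have := hu s sT; rewrite (ger0_norm (upos _ sT')) ler_norml => /andP[+ _].
    by rewrite -subr_ge0 opprK.
  - move=> r rT'; have rT : 0 <= r <= T by lra.
    rewrite uE// eE//.
    have -> : u 0 + abel h r - u 0 * (1 - lam * abel e r) =
      abel h r + (u 0 * lam) * abel e r by ring.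
    rewrite -abelZ -?abelD//; try exact: lbm_continuous.
      by congr abel; apply/funext => s; ring.
    by apply: lbmZ; exact: lbm_continuous.
  - by rewrite T'0 lexx.
(* At a first zero [t1] the sign condition of [key] still holds on all of [[0, t1]], and [key] gives
   [u t1 >= u 0 * e t1 > 0]. *)
have upos t : 0 <= t <= T -> 0 < u t.
  move=> tT; rewrite ltNge; apply/negP => ut.
  have [t1 [/andP[t10 t1T] ut1 before]] := first_zero cu tT u0 ut.
  have t1T' : 0 <= t1 <= T by rewrite t1T ltW.
  have := key t1 t1T'; rewrite ut1 leNgt mulr_gt0 ?epos//= => H.
  suff : false by []. apply: H => s /andP[s0].
  rewrite le_eqVlt => /predU1P[->|st1]; first by rewrite ut1.
  by apply/ltW/before; rewrite s0.
by move=> t tT; apply: key => // s sT; apply/ltW/upos; lra.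
Qed.

(** Continuity is only asked along continuous paths; in this form it passes directly to a vector
    field whose other coordinates are frozen along a path. *)
Definition scalar_rhs (Lam : R) (G : R -> R -> R) :=
  (forall x, continuous x -> continuous (fun t => G t (x t))) /\
  (forall t (x y : R), `|G t x - G t y| <= Lam * `|x - y|).

Definition scalar_sol (T : R) (G : R -> R -> R) x :=
  continuous x /\ forall t, 0 <= t <= T -> x t = x 0 + abel (fun s => G s (x s)) t.

Lemma scalar_ivp (Lam T : R) G (x0 : R) : 0 <= Lam -> 0 <= T -> scalar_rhs Lam G ->
  exists2 x, scalar_sol T G x & x 0 = x0.
Proof.
move=> L0 T0 [GC GL].
have [|x [cx xE]] := @volterra_exists R alpha alpha01 G (fun=> x0) Lam T L0 T0 GC GL.
  by move=> t; exact: cst_continuous.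
have x00 : x 0 = x0 by rewrite xE ?lexx// abel0// addr0.
by exists x => //; split => // t tT; rewrite x00 xE.
Qed.

Lemma scalar_perturbation (Lam T : R) : 0 <= Lam -> 0 <= T -> exists2 C, 0 < C &
  forall G x y (b : R -> R) (B : R), scalar_rhs Lam G -> continuous x -> continuous y -> continuous b ->
    (forall t, 0 <= t <= T -> x t = x 0 + abel (fun s => G s (x s)) t) ->
    (forall t, 0 <= t <= T -> y t = y 0 + abel (fun s => G s (y s) + b s) t) ->
    (forall t, 0 <= t <= T -> `|b t| <= B) ->
  forall t, 0 <= t <= T -> `|x t - y t| <= C * (`|x 0 - y 0| + B).
Proof.
move=> L0 T0; have [C C0 gron] := abel_gronwall alpha01 L0 T0.
pose D := 1 + T `^ alpha / alpha.
have D1 : 1 <= D by rewrite /D lerDl divr_ge0 ?powR_ge0// ltW.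
exists (C * D); first by rewrite mulr_gt0//; lra.
move=> G x y b B [GC GL] cx cy cb xE yE bB t tT.
have B0 : 0 <= B by apply: le_trans (bB 0 _); rewrite ?normr_ge0 ?lexx.
have TT : 0 <= T <= T by rewrite T0 lexx.
have lG (v : R -> R) : continuous v -> lbm (fun s => G s (v s)).
  by move=> cv; apply: lbm_continuous; exact: GC.
have lb := lbm_continuous cb.
have cd := continuousB_real cx cy.
have A0 : 0 <= `|x 0 - y 0| + B * (T `^ alpha / alpha).
  by rewrite addr_ge0// mulr_ge0// divr_ge0 ?powR_ge0// ltW.
apply: (@le_trans _ _ (C * (`|x 0 - y 0| + B * (T `^ alpha / alpha)))).
  apply: (gron _ _ T cd A0 TT _ t tT) => r rT.
  have /andP[r0 rleT] := rT.
  rewrite xE// (yE r)// abelD//; last exact: lG.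
  have -> : x 0 + abel (fun s => G s (x s)) r -
    (y 0 + (abel (fun s => G s (y s)) r + abel b r)) =
    (x 0 - y 0) - abel b r + (abel (fun s => G s (x s)) r - abel (fun s => G s (y s)) r) by ring.
  apply: le_trans (ler_normD _ _) _; apply: lerD.
    apply: le_trans (ler_normB _ _) _; rewrite lerD2l.
    apply: (@le_trans _ _ (abel (fun=> B) r)).
      apply: le_norm_abel => //; first exact: lbm_cst.
      by move=> s sr; apply: bB; lra.
    rewrite abel_cst// ler_wpM2l// ler_pM2r ?invr_gt0//.
    by apply: ge0_ler_powR; rewrite ?nnegrE//; exact: ltW.
  rewrite -abelB; [|exact: alpha01|exact: lG|exact: lG].
  have ln : lbm (fun s => `|x s - y s|) by apply: lbm_norm; exact: lbm_continuous.
  rewrite -abelZ//; apply: le_norm_abel => //.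
  - by apply: lbmB; exact: lG.
  - exact: lbmZ.
rewrite -mulrA ler_pM2l// /D mulrDr mulrDl mul1r mulrDl mul1r.
have : 0 <= (T `^ alpha / alpha) * `|x 0 - y 0| by rewrite mulr_ge0// divr_ge0 ?powR_ge0// ltW.
rewrite (mulrC B); lra.
Qed.

(** [c] is the minimum over [[0, T]] of the resolvent for [Lam + 1], a strictly positive rate as
    [comparison] demands. *)
Lemma scalar_separation (Lam T : R) : 0 <= Lam -> 0 <= T -> exists2 c, 0 < c &
  forall G x y, scalar_rhs Lam G -> scalar_sol T G x -> scalar_sol T G y ->
  y 0 < x 0 -> forall t, 0 <= t <= T -> c * (x 0 - y 0) <= x t - y t.
Proof.
move=> L0 T0; have l0 : 0 < Lam + 1 by lra.
have [e [ce eE epos]] := resolvent_exists alpha01 (ltW l0) T0.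
have cw : {within `[0, T], continuous e} by exact: continuous_subspaceT.
have [r] := EVT_min T0 cw; rewrite in_itv/= => rT emin.
exists (e r); first exact: epos.
move=> G x y [GC GL] [cx xE] [cy yE] xy t tT.
have u0 : 0 < x 0 - y 0 by rewrite subr_gt0.
apply: (@le_trans _ _ ((x 0 - y 0) * e t)).
  by rewrite mulrC ler_pM2l// emin// in_itv.
have ch : continuous (fun s => G s (x s) - G s (y s)) by apply: continuousB_real; exact: GC.
apply: (@comparison (fun s => x s - y s) (fun s => G s (x s) - G s (y s)) e (Lam + 1) T) => //.
- exact: continuousB_real.
- move=> s sT; rewrite xE// (yE s)// abelB//; try by apply: lbm_continuous; exact: GC.
  by ring.
- by move=> s _; apply: le_trans (GL _ _ _) _; rewrite ler_wpM2r// lerDl.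
Qed.

(** The estimate goes from [s] back to 0 by separation and from 0 to [t] by perturbation. Separation
    compares exact solutions, so [y] is first replaced by the solution [y1] with the same initial
    value, at cost [C * B]. *)
Lemma scalar_two_sided (Lam T : R) : 0 <= Lam -> 0 <= T -> exists2 C, 0 < C &
  forall G x y (b : R -> R) (B : R), scalar_rhs Lam G -> scalar_sol T G x -> continuous y -> continuous b ->
    (forall t, 0 <= t <= T -> y t = y 0 + abel (fun s => G s (y s) + b s) t) ->
    (forall t, 0 <= t <= T -> `|b t| <= B) ->
  forall s t, 0 <= s <= T -> 0 <= t <= T -> `|x t - y t| <= C * (`|x s - y s| + B).
Proof.
move=> L0 T0.
have [C C0 pert] := scalar_perturbation L0 T0.
have [c c0 sep] := scalar_separation L0 T0.
exists (C / c * (1 + C) + C).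
  by rewrite addr_gt0// mulr_gt0 ?divr_gt0//; lra.
move=> G x y b B GP [cx xE] cy cb yE bB s t sT tT.
have B0 : 0 <= B by apply: le_trans (bB 0 _); rewrite ?normr_ge0 ?lexx.
have [y1 [cy1 y1E] y10] := scalar_ivp (y 0) L0 T0 GP.
have d1 r : 0 <= r <= T -> `|y1 r - y r| <= C * B.
  move=> rT; apply: le_trans (pert G y1 y b B GP cy1 cy cb y1E yE bB r rT) _.
  by rewrite y10 subrr normr0 add0r.
have d2 : c * `|x 0 - y 0| <= `|x s - y1 s|.
  have [lt|lt|->] := ltgtP (x 0) (y 0); last by rewrite subrr normr0 mulr0.
    rewrite distrC gtr0_norm ?subr_gt0// distrC; apply: le_trans (ler_norm _).
    by rewrite -y10; apply: (sep G) => //; rewrite y10.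
  rewrite gtr0_norm ?subr_gt0//; apply: le_trans (ler_norm _).
  by rewrite -y10; apply: (sep G) => //; rewrite y10.
have d3 : `|x s - y1 s| <= `|x s - y s| + C * B.
  have -> : x s - y1 s = (x s - y s) - (y1 s - y s) by ring.
  by apply: le_trans (ler_normB _ _) _; rewrite lerD2l d1.
apply: le_trans (pert G x y b B GP cx cy cb xE yE bB t tT) _.
have d4 : `|x 0 - y 0| <= (`|x s - y s| + C * B) / c.
  by rewrite ler_pdivlMr// mulrC; apply: le_trans d2 d3.
apply: (@le_trans _ _ (C * ((`|x s - y s| + C * B) / c + B))).
  by rewrite ler_pM2l// lerD2r.
set X := `|x s - y s|; have X0 : 0 <= X by exact: normr_ge0.
rewrite -subr_ge0.
have -> : (C / c * (1 + C) + C) * (X + B) - C * ((X + C * B) / c + B) =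
  C / c * (B + C * X) + C * X by field; rewrite gt_eqF.
have C0' := ltW C0; have Cc : 0 <= C / c by apply: ltW; exact: divr_gt0.
by apply: addr_ge0; apply: mulr_ge0 => //; apply: addr_ge0 => //; exact: mulr_ge0.
Qed.

(** [Phi], from initial value to value at [s], is Lipschitz by perturbation and stretches distances
    at least by [c] by separation. Hence its values at [- r] and [r] enclose [v]. *)
Lemma scalar_target (Lam T : R) G s (v : R) : 0 <= Lam -> 0 <= T -> scalar_rhs Lam G ->
  0 <= s <= T -> exists2 x, scalar_sol T G x & x s = v.
Proof.
move=> L0 T0 GP sT.
have [C C0 pert] := scalar_perturbation L0 T0.
have [c c0 sep] := scalar_separation L0 T0.
have EX (x0 : R) : exists x, scalar_sol T G x /\ x 0 = x0.
  by have [x ? ?] := scalar_ivp x0 L0 T0 GP; exists x.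
pose X (x0 : R) := projT1 (cid (EX x0)).
have XS (x0 : R) : scalar_sol T G (X x0) by case: (projT2 (cid (EX x0))).
have X0 (x0 : R) : X x0 0 = x0 by case: (projT2 (cid (EX x0))).
pose Phi (x0 : R) := X x0 s.
have lip a b : `|Phi a - Phi b| <= C * `|a - b|.
  have [ca aE] := XS a; have [cb bE] := XS b.
  have := pert G (X a) (X b) (fun=> 0) 0 GP ca cb _ aE _ _ s sT.
  rewrite addr0 !X0; apply.
  - by move=> t; exact: cst_continuous.
  - move=> t tT; rewrite {1}bE// X0; congr (_ + abel _ _); apply/funext => r.
    by rewrite addr0.
  - by move=> t _; rewrite normr0.
have cPhi : continuous Phi.
  move=> a; apply/cvgrPdist_le => e e0; near=> b.
  apply: le_trans (lip a b) _; rewrite mulrC -ler_pdivlMr//.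
  by near: b; apply: cvgr_dist_le => //; rewrite divr_gt0.
pose r := `|v - Phi 0| / c.
have r0 : 0 <= r by rewrite divr_ge0// ltW.
have hi : v <= Phi r.
  (* [sep] needs distinct initial values, so the case [v = Phi 0] is treated apart. *)
  have [r00|rn0] := eqVneq r 0.
    move/eqP: (r00); rewrite /r mulf_eq0 invr_eq0 (gt_eqF c0) orbF normr_eq0 subr_eq0 => /eqP.
    by rewrite -/r r00 => ->.
  have rp : 0 < r by rewrite lt_neqAle eq_sym rn0.
  have := sep G _ _ GP (XS r) (XS 0); rewrite !X0 => /(_ rp s sT).
  rewrite -/(Phi r) -/(Phi 0) subr0 /r mulrC divfK ?gt_eqF//.
  have := ler_norm (v - Phi 0); lra.
have lo : Phi (- r) <= v.
  have [r00|rn0] := eqVneq r 0.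
    move/eqP: (r00); rewrite /r mulf_eq0 invr_eq0 (gt_eqF c0) orbF normr_eq0 subr_eq0 => /eqP.
    by rewrite -/r r00 oppr0 => ->.
  have rp : - r < 0 by rewrite oppr_lt0 lt_neqAle eq_sym rn0.
  have := sep G _ _ GP (XS 0) (XS (- r)); rewrite !X0 => /(_ rp s sT).
  rewrite -/(Phi (- r)) -/(Phi 0) sub0r opprK /r mulrC divfK ?gt_eqF//.
  have := ler_norm (- (v - Phi 0)); rewrite normrN; lra.
have cw : {within `[- r, r], continuous Phi} by exact: continuous_subspaceT.
have le : - r <= r by lra.
have /(IVT le cw)[a _ Ha] : Num.min (Phi (- r)) (Phi r) <= v <= Num.max (Phi (- r)) (Phi r).
  by rewrite ge_min lo le_max hi orbT.
by exists (X a).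
Unshelve. all: by end_near. Qed.

End ScalarFlow.

(** * Vector systems, by induction on the rank of a coordinate *)

Section VectorFlow.
Context {R : realType} (alpha : R) (d : nat) (rk : 'I_d -> nat).
Hypothesis alpha01 : 0 < alpha < 1.
Hypothesis rk_inj : injective rk.
Local Notation abel := (abel alpha).
Implicit Types (X Y : R -> 'cV[R]_d) (F : R -> 'cV[R]_d -> 'cV[R]_d) (s t T Lam : R).

Definition path_continuous X := forall i, continuous (fun t => X t i 0).

(* [rk] lists the coordinates in the order in which the system can be solved. *)
Definition tri_rhs Lam F :=
  [/\ forall X, path_continuous X -> forall i, continuous (fun t => F t (X t) i 0),
      forall t (v w : 'cV[R]_d) (B : R) i, (forall j, `|v j 0 - w j 0| <= B) ->
        `|F t v i 0 - F t w i 0| <= Lam * B &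
      forall t (v w : 'cV[R]_d) i, (forall j, (rk j <= rk i)%N -> v j 0 = w j 0) ->
        F t v i 0 = F t w i 0].

Definition vec_sol T F X := path_continuous X /\
  forall i t, 0 <= t <= T -> X t i 0 = X 0 i 0 + abel (fun s => F s (X s) i 0) t.

Definition upd (v : 'cV[R]_d) (i : 'I_d) (r : R) : 'cV[R]_d :=
  \col_j (if j == i then r else v j 0).

Lemma updE v i r j : upd v i r j 0 = if j == i then r else v j 0.
Proof. by rewrite mxE. Qed.

Lemma path_continuous_upd X i (x : R -> R) : path_continuous X -> continuous x ->
  path_continuous (fun t => upd (X t) i (x t)).
Proof.
move=> cX cx j.
have [->|ji] := eqVneq j i.
  by rewrite (_ : (fun t => _) = x)//; apply/funext => t; rewrite updE eqxx.
rewrite (_ : (fun t => _) = fun t => X t j 0)//.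
by apply/funext => t; rewrite updE (negbTE ji).
Qed.

Lemma scalar_rhs_upd Lam F X i : tri_rhs Lam F -> path_continuous X ->
  scalar_rhs Lam (fun t r => F t (upd (X t) i r) i 0).
Proof.
move=> [FC FL _] cX; split => [x cx|t x y].
  by apply: FC; exact: path_continuous_upd.
apply: FL => j; rewrite !updE; case: ifP => // _.
by rewrite subrr normr0.
Qed.

(** [rk] is only injective and may skip values; at such a [k] the induction in [vec_target] has
    nothing to solve. *)
Lemma rk_case k : (exists i, rk i = k) \/ (forall i, rk i <> k).
Proof.
have [[i /eqP <-]|H] := pselect (exists i, rk i == k); first by left; exists i.
by right => i ik; apply: H; exists i; apply/eqP.
Qed.

Lemma rk_bound : exists n, forall i, (rk i < n)%N.
Proof. by exists (\max_i rk i).+1 => i; rewrite ltnS; exact: leq_bigmax. Qed.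

(** Coordinates of rank at least [k] are arbitrary continuous placeholders. Replacing the one of
    rank [k] by the solution of its scalar equation leaves the equations of lower rank intact. *)
Lemma vec_target Lam T F s (v : 'cV[R]_d) : 0 <= Lam -> 0 <= T -> tri_rhs Lam F ->
  0 <= s <= T -> exists2 X, vec_sol T F X & X s = v.
Proof.
move=> L0 T0 FP sT.
have [FC FL F3] := FP.
suff H k : exists2 X, path_continuous X & forall i, (rk i < k)%N ->
    (forall t, 0 <= t <= T -> X t i 0 = X 0 i 0 + abel (fun s => F s (X s) i 0) t) /\
    X s i 0 = v i 0.
  have [n Hn] := rk_bound; have [X cX HX] := H n.
  exists X; first by split => // i; case: (HX i (Hn i)).
  by apply/colP => i; case: (HX i (Hn i)).
elim: k => [|k [X cX HX]].
  by exists (fun=> 0) => // i t; exact: cst_continuous.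
have [[i0 rki0]|nok] := rk_case k; last first.
  exists X => // i; rewrite ltnS leq_eqVlt => /predU1P[/nok//|]; exact: HX.
have [x [cx xE] xs] := scalar_target alpha01 (v i0 0) L0 T0 (scalar_rhs_upd i0 FP cX) sT.
exists (fun t => upd (X t) i0 (x t)); first exact: path_continuous_upd.
move=> i; rewrite ltnS leq_eqVlt => /predU1P[iE|ik].
  have -> : i = i0 by apply: rk_inj; rewrite iE rki0.
  by split => [t tT|]; rewrite !updE eqxx//; exact: xE.
have ii0 : i != i0 by apply: contraTneq ik => ->; rewrite rki0 ltnn.
have [XE Xs] := HX i ik; split => [t tT|]; rewrite !updE (negbTE ii0)//.
rewrite XE//; congr (_ + abel _ _); apply/funext => r.
apply: F3 => j ji; rewrite updE ifN//.
by apply: contraTneq ji => ->; rewrite rki0 -ltnNge.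
Qed.

(** Freeze all coordinates but [i] along [X]. Then [X] solves the scalar equation of [i] exactly,
    and [Y] solves it up to an error [b] controlled by the coordinates of lower rank. *)
Lemma vec_two_sided Lam T : 0 <= Lam -> 0 <= T -> exists2 C, 0 < C &
  forall F X Y, tri_rhs Lam F -> vec_sol T F X -> vec_sol T F Y ->
  forall s t B, 0 <= s <= T -> 0 <= t <= T ->
  (forall i, `|X s i 0 - Y s i 0| <= B) -> forall i, `|X t i 0 - Y t i 0| <= C * B.
Proof.
move=> L0 T0; have [n Hn] := rk_bound.
suff H k : exists2 C, 0 < C &
  forall F X Y, tri_rhs Lam F -> vec_sol T F X -> vec_sol T F Y ->
  forall s B, 0 <= s <= T -> (forall i, `|X s i 0 - Y s i 0| <= B) ->
  forall t, 0 <= t <= T -> forall i, (rk i < k)%N -> `|X t i 0 - Y t i 0| <= C * B.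
  have [C C0 HC] := H n; exists C => // F X Y FP XP YP s t B sT tT XYB i.
  exact: (HC F X Y FP XP YP s B sT XYB t tT i (Hn i)).
elim: k => [|k [C C0 HC]]; first by exists 1.
have [D D0 HD] := scalar_two_sided alpha01 L0 T0.
(* The second summand bounds rank [k], from difference [B] and error [Lam * (C * B)]; adding [C]
   keeps the lower ranks covered. *)
exists (C + D * (1 + Lam * C)).
  by rewrite addr_gt0// mulr_gt0// ltr_wpDr// mulr_ge0// ltW.
move=> F X Y FP XP YP s B sT XYB t tT i.
have B0 : 0 <= B by apply: le_trans (XYB i); exact: normr_ge0.
rewrite ltnS leq_eqVlt => /predU1P[ik|ik]; last first.
  apply: le_trans (HC F X Y FP XP YP s B sT XYB t tT i ik) _.
  by rewrite ler_wpM2r// lerDl mulr_ge0 ?ltW// ltr_wpDr// mulr_ge0// ltW.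
have [cX XE] := XP; have [cY YE] := YP; have [FC FL F3] := FP.
pose G t r := F t (upd (X t) i r) i 0.
have GP : scalar_rhs Lam G by exact: scalar_rhs_upd.
pose b t := F t (Y t) i 0 - G t (Y t i 0).
have cb : continuous b.
  apply: continuousB_real; first exact: FC.
  by apply: FC; exact: path_continuous_upd.
have updid (v : 'cV[R]_d) : upd v i (v i 0) = v.
  by apply/colP => j; rewrite updE; case: eqP => // ->.
have xsol : scalar_sol alpha T G (fun t => X t i 0).
  split => // r rT; rewrite XE//; congr (_ + abel _ _).
  by apply/funext => q; rewrite /G updid.
have ysol r : 0 <= r <= T ->
    Y r i 0 = Y 0 i 0 + abel (fun s => G s (Y s i 0) + b s) r.
  move=> rT; rewrite YE//; congr (_ + abel _ _).
  by apply/funext => q; rewrite /b addrCA subrr addr0.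
have bB r : 0 <= r <= T -> `|b r| <= Lam * (C * B).
  (* Nothing is known yet about ranks above [k]. Component [i] does not see them, so [Y] may take
     the values of [X] there before the Lipschitz bound is applied. *)
  move=> rT; pose W := \col_j (if (rk j <= k)%N then Y r j 0 else X r j 0) : 'cV[R]_d.
  have -> : b r = F r W i 0 - G r (Y r i 0).
    by congr (_ - _); apply: F3 => j ji; rewrite mxE -ik ji.
  apply: FL => j; rewrite updE mxE.
  have [jk|jk|jk] := ltngtP (rk j) k.
  - rewrite ifN; last by apply: contraTneq jk => ->; rewrite ik ltnn.
    by rewrite distrC; exact: (HC F X Y FP XP YP s B sT XYB r rT j jk).
  - rewrite ifN; last by apply: contraTneq jk => ->; rewrite ik ltnn.
    by rewrite subrr normr0 mulr_ge0// ltW.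
  - have -> : j = i by apply: rk_inj; rewrite ik.
    by rewrite eqxx subrr normr0 mulr_ge0// ltW.
have := HD G _ _ b _ GP xsol (cY i) cb ysol bB s t sT tT.
move=> /le_trans; apply.
apply: (@le_trans _ _ (D * (B + Lam * (C * B)))).
  by rewrite ler_pM2l// lerD2r.
rewrite -subr_ge0 (_ : _ - _ = C * B); last by ring.
by rewrite mulr_ge0// ltW.
Qed.

Lemma tri_rhsZ Lam F c : tri_rhs Lam F -> tri_rhs (`|c| * Lam) (fun t v => c *: F t v).
Proof.
move=> [FC FL F3]; split.
- move=> X cX i; rewrite (_ : (fun t => _) = fun t => c * F t (X t) i 0).
    by apply: continuousZ_real; exact: FC.
  by apply/funext => t; rewrite mxE.
- move=> t v w B i vw; rewrite !mxE -mulrBr normrM -mulrA ler_wpM2l//.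
  exact: FL.
- by move=> t v w i vw; rewrite !mxE (F3 _ _ w).
Qed.

End VectorFlow.

(** * Coordinates, norm and continuity *)

Section MatrixTopology.
Context {R : realType}.

Lemma near_dist_lt (V : normedModType R) (v : V) (e : R) : 0 < e ->
  \forall w \near v, `|v - w| < e.
Proof.
move=> e0; near=> w; near: w; exact: cvgr_dist_lt.
Unshelve. all: by end_near. Qed.

Lemma coord_le_norm m n (A : 'M[R]_(m, n)) i j : `|A i j| <= `|A|.
Proof.
rewrite [leRHS]/Num.norm/= mx_normrE.
exact: (le_bigmax _ (fun ij : 'I_m * 'I_n => `|A ij.1 ij.2|) (i, j)).
Qed.

Lemma norm_le_coord m n (A : 'M[R]_(m, n)) (B : R) : 0 <= B ->
  (forall i j, `|A i j| <= B) -> `|A| <= B.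
Proof.
move=> B0 AB; rewrite [leLHS]/Num.norm/= mx_normrE.
by apply: bigmax_le => // -[i j] _; exact: AB.
Qed.

Lemma path_continuousP d (X : R -> 'cV[R]_d) : path_continuous X <-> continuous X.
Proof.
split => [cX t|cX i t]; last first.
  by apply: (@continuous_comp _ _ _ X (fun v : 'cV[R]_d => v i 0)); [exact: cX|exact: coord_continuous].
apply/cvgrPdist_le => e e0.
have H : \forall s \near t, forall i : 'I_d, `|X t i 0 - X s i 0| <= e.
  have Hi (i : 'I_d) : \forall s \near t, `|X t i 0 - X s i 0| <= e.
    by have := cX i t; move/cvgrPdist_le => /(_ _ e0).
  exact: (filter_forall (nbhs_filter t) Hi).
apply: filterS H => s Hs; apply: norm_le_coord; first exact: ltW.
by move=> i j; rewrite ord1 !mxE.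
Qed.

Lemma continuous_comp_within (T U V : topologicalType) (A : set U) (f : U -> V)
    (g : T -> U) : {within A, continuous f} -> continuous g -> (forall x, A (g x)) ->
  continuous (f \o g).
Proof.
move=> /subspace_continuousP cf cg Ag x.
apply: (cvg_comp _ _ _ (cf (g x) (Ag x))) => P.
rewrite /within/= => HP.
by apply: (filterS _ (cg x _ HP : nbhs x _)) => y; apply; exact: Ag.
Qed.

End MatrixTopology.

(** * The time interval *)

Section TimeInterval.
Context {R : realType}.
Implicit Types (T : \bar R) (s t : R).

Lemma Jset0 T : (0 < T)%E -> Jset T 0.
Proof. by move=> T0; split => //; exact: ltW. Qed.

Lemma Jset_le T s t : Jset T t -> 0 <= s <= t -> Jset T s.
Proof.
move=> [t0 tT] /andP[s0 st]; split => //.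
by apply: le_trans tT; rewrite lee_fin.
Qed.

(** A neighbourhood of [t] in [J] lies in one compact [[0, tau]], on which a single constant is
    valid: [tau] is the right end of [J], or [t + 1] on the half-line. *)
Lemma Jset_local T t : Jset T t -> exists2 tau, Jset T tau &
  forall s, Jset T s -> `|t - s| < 1 -> s <= tau.
Proof.
case: T => [r| |] [t0 tT].
- exists r; first by split; [apply: le_trans t0 _; rewrite -lee_fin | rewrite lexx].
  by move=> s [_ + _]; rewrite lee_fin.
- exists (t + 1); first by split; [rewrite addr_ge0 | rewrite leey].
  by move=> s _; rewrite ltr_norml => /andP[+ _]; lra.
- by move: tT; rewrite leNgt ltNyr.
Qed.

Lemma Jset_max T s t : Jset T s -> Jset T t -> Jset T (Num.max s t).
Proof. by case: (leP s t). Qed.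

Lemma Jset_clamp T t s : Jset T t -> Jset T (clamp t s).
Proof. by move=> Jt; apply: (Jset_le Jt); apply: clamp_itv; case: Jt. Qed.

End TimeInterval.

(** * The flow of an abstract triangular system on [J] *)

Section TriangularFlow.
Context {R : realType} (alpha : R) (d : nat) (rk : 'I_d -> nat) (T : \bar R).
Context (F : R -> 'cV[R]_d -> 'cV[R]_d).
Hypothesis alpha01 : 0 < alpha < 1.
Hypothesis rk_inj : injective rk.
Hypothesis T0 : (0 < T)%E.
Local Notation J := (Jset T).
(** [F] is meaningful on [J] only and its Lipschitz constant may grow on the half-line, hence one
    clamped field and one [Lam] for each [tau]. *)
Hypothesis F_tri : forall tau, J tau ->
  exists2 Lam, 0 <= Lam & tri_rhs rk Lam (fun t => F (clamp tau t)).
Local Notation mu := (@lebesgue_measure R).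
Local Notation abel := (abel alpha).
Implicit Types (x y X Y : R -> 'cV[R]_d) (s t tau : R).

Let Fc tau t v : 'cV[R]_d := (Gamma alpha)^-1 *: F (clamp tau t) v.

Let Fc_tri tau : J tau -> exists2 Lam, 0 <= Lam & tri_rhs rk Lam (Fc tau).
Proof.
move=> /F_tri[Lam L0 FP]; exists (`|(Gamma alpha)^-1| * Lam).
  by rewrite mulr_ge0.
exact: tri_rhsZ.
Qed.

Let abel_Fc tau X i t : J tau -> continuous X -> 0 <= t <= tau ->
  abel (fun s => Fc tau s (X s) i 0) t = (Gamma alpha)^-1 *
    Rintegral mu `[0, t]%classic (fun s => (t - s) `^ (alpha - 1) * F s (X s) i 0).
Proof.
move=> Jt cX tT; have [Lam L0 [FC _ _]] := F_tri Jt.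
have -> : (fun s => Fc tau s (X s) i 0) =
    (fun s => (Gamma alpha)^-1 * F (clamp tau s) (X s) i 0).
  by apply/funext => s; rewrite mxE.
rewrite abelZ//; last by apply: lbm_continuous; apply: FC; apply/path_continuousP.
congr (_ * _); apply: eq_Rintegral => s; rewrite inE/= in_itv/= => st.
by rewrite clamp_id//; lra.
Qed.

Lemma is_solution_restrict x tau : is_solution alpha J F x -> J tau ->
  vec_sol alpha tau (Fc tau) (fun t => x (clamp tau t)).
Proof.
move=> [cx xE] Jt; have [tau0 _] := Jt.
have cX : continuous (fun t => x (clamp tau t)).
  apply: (continuous_comp_within cx); first exact: continuous_clamp.
  by move=> t; exact: Jset_clamp.
split; first exact/path_continuousP.
move=> i t tT; rewrite abel_Fc// !clamp_id ?lexx//.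
have [_ ->] := xE t (Jset_le Jt tT) i.
congr (_ + _ * _); apply: eq_Rintegral => s; rewrite inE/= in_itv/= => st.
by rewrite clamp_id//; lra.
Qed.

Lemma vec_sol_shorten X tau tau' : J tau' -> 0 <= tau <= tau' ->
  vec_sol alpha tau' (Fc tau') X -> vec_sol alpha tau (Fc tau) X.
Proof.
move=> Jt tt [cX XE]; split => // i t tT.
have cX' : continuous X by apply/path_continuousP.
rewrite XE; last by lra.
rewrite (abel_Fc _ Jt cX'); last by lra.
by rewrite (abel_Fc _ (Jset_le Jt tt) cX').
Qed.

Lemma vec_sol_unique X Y tau : J tau ->
  vec_sol alpha tau (Fc tau) X -> vec_sol alpha tau (Fc tau) Y -> X 0 = Y 0 ->
  forall t, 0 <= t <= tau -> X t = Y t.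
Proof.
move=> Jt XP YP XY0 t tT; have [Lam L0 FP] := Fc_tri Jt; have [tau0 _] := Jt.
have [C C0 HC] := vec_two_sided alpha01 rk_inj L0 tau0.
apply/colP => i; apply/eqP; rewrite -subr_eq0 -normr_le0.
have := HC _ X Y FP XP YP 0 t 0; rewrite mulr0; apply => //.
- by rewrite lexx.
- by move=> j; rewrite XY0 subrr normr0.
Qed.

(** Solving on [[0, s]] with value [v] at [s] yields an initial value. From it one solves on every
    [[0, tau]] and glues by [x t := X t t]; uniqueness makes [x] agree with each [X tau] on
    [[0, tau]]. *)
Lemma is_solution_target s (v : 'cV[R]_d) : J s ->
  exists x, is_solution alpha J F x /\ x s = v.
Proof.
move=> Js; have [s0 _] := Js.
have [Y YP Ys] : exists2 Y, vec_sol alpha s (Fc s) Y & Y s = v.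
  have [Lam L0 FP] := Fc_tri Js.
  by apply: (vec_target alpha01 rk_inj _ L0 s0 FP); rewrite s0 lexx.
have EX tau : exists X, J tau -> vec_sol alpha tau (Fc tau) X /\ X 0 = Y 0.
  have [Jt|nJ] := pselect (J tau); last by exists (fun=> 0).
  have [Lam L0 FP] := Fc_tri Jt; have [tau0 _] := Jt.
  have [|X XP X0] := vec_target alpha01 rk_inj (Y 0) L0 tau0 FP (s := 0).
    by rewrite lexx.
  by exists X.
pose X tau := projT1 (cid (EX tau)).
have XP tau : J tau -> vec_sol alpha tau (Fc tau) (X tau) /\ X tau 0 = Y 0.
  exact: (projT2 (cid (EX tau))).
pose x t := X t t.
have xX tau t : J tau -> 0 <= t <= tau -> x t = X tau t.
  move=> Jt tT; have [P1 P2] := XP _ Jt.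
  have Jt' := Jset_le Jt tT; have [P3 P4] := XP _ Jt'.
  apply: (vec_sol_unique Jt' P3 (vec_sol_shorten Jt tT P1)); first by rewrite P2 P4.
  by case/andP: tT => ->; rewrite lexx.
have J0 : J 0 by exact: Jset0.
exists x; split; last first.
  have [P1 P2] := XP _ Js.
  by rewrite -Ys /x; apply: (vec_sol_unique Js P1 YP) => //; rewrite s0 lexx.
split.
  apply/subspace_continuousP => t Jt.
  have [tau Jtau Htau] := Jset_local Jt.
  have [[cX _] _] := XP _ Jtau.
  have [t0 _] := Jt.
  have tt : t <= tau by apply: Htau; rewrite // subrr normr0.
  have xt : x t = X tau t by apply: xX => //; rewrite t0.
  have cXt := (path_continuousP (X tau)).1 cX t.
  have := @cvg_within_filter _ _ (X tau) _ (nbhs_filter t) _ J cXt.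
  rewrite -xt; apply: cvg_trans; apply: near_eq_cvg.
  have Lt := near_dist_lt t ltr01.
  rewrite near_withinE; apply: filterS Lt => r tr Jr.
  have [r0 _] := Jr.
  by apply/esym/xX => //; rewrite r0/=; exact: Htau.
move=> t Jt i.
have [[cX XE] X0] := XP _ Jt; have [t0 _] := Jt.
have cX' : continuous (X t) by apply/path_continuousP.
have tt : 0 <= t <= t by rewrite t0 lexx.
have [Lam L0 [FC _ _]] := F_tri Jt.
have E : {in `[0, t]%classic, forall r : R, (t - r) `^ (alpha - 1) * F (clamp t r) (X t r) i 0 =
    (t - r) `^ (alpha - 1) * F r (x r) i 0}.
  by move=> r; rewrite inE/= in_itv/= => rt; rewrite clamp_id// (xX t).
split.
  apply: (@eq_integrable _ _ _ mu `[0, t] _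
    (fun r => ((t - r) `^ (alpha - 1) * F (clamp t r) (X t r) i 0)%:E)) => //.
    by move=> r rt; rewrite E.
  by apply: abel_integrable => //; apply: lbm_continuous; exact: FC.
rewrite (xX t t Jt tt) (xX t 0 Jt) ?lexx ?t0// XE// abel_Fc//.
congr (_ + _ * _); apply: eq_Rintegral => r; rewrite inE/= in_itv/= => rt.
by rewrite (xX t).
Qed.

Lemma is_solution_two_sided tau : J tau -> exists2 C, 0 < C &
  forall x y, is_solution alpha J F x -> is_solution alpha J F y ->
  forall s t, 0 <= s <= tau -> 0 <= t <= tau -> `|x t - y t| <= C * `|x s - y s|.
Proof.
move=> Jt; have [Lam L0 FP] := Fc_tri Jt; have [tau0 _] := Jt.
have [C C0 HC] := vec_two_sided alpha01 rk_inj L0 tau0.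
exists C => // x y xP yP s t sT tT; apply: norm_le_coord.
  by rewrite mulr_ge0// ltW.
move=> i j; rewrite ord1 !mxE.
have := HC _ _ _ FP (is_solution_restrict xP Jt) (is_solution_restrict yP Jt) s t
  `|x s - y s| sT tT.
rewrite !clamp_id//; apply => k.
by have := coord_le_norm (x s - y s) k 0; rewrite !mxE.
Qed.

Lemma is_solution_unique x y s t : is_solution alpha J F x -> is_solution alpha J F y ->
  J s -> J t -> x s = y s -> x t = y t.
Proof.
move=> xP yP Js Jt xy.
have [C C0 HC] := is_solution_two_sided (Jset_max Js Jt).
have [s0 _] := Js; have [t0 _] := Jt.
have := HC x y xP yP s t; rewrite xy subrr normr0 mulr0.
rewrite s0 t0 !le_max !lexx orbT => /(_ isT isT).
by rewrite normr_le0 subr_eq0 => /eqP.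
Qed.

Local Notation phi0 := (evol alpha J F).

Lemma evolP (v : 'cV[R]_d) : is_solution alpha J F (phi0 ^~ v) /\ phi0 0 v = v.
Proof. exact: (ClassicalEpsilon.epsilon_spec _ _ (is_solution_target v (Jset0 T0))). Qed.

Lemma evol_unique x t : is_solution alpha J F x -> J t -> x t = phi0 t (x 0).
Proof.
move=> xP Jt; have [eP e0] := evolP (x 0).
by apply: (is_solution_unique xP eP (Jset0 T0) Jt); rewrite e0.
Qed.

(** [psi s v] is the initial value of the solution through [v] at time [s]. Injectivity of [phi0 s]
    is uniqueness read from time [s] back to 0, and the flow identities are cancellations. *)
Theorem triangular_flow :
  (forall t, J t -> bijective (phi0 t)) /\
  exists psi : R -> 'cV[R]_d -> 'cV[R]_d,
    (forall s, J s -> cancel (phi0 s) (psi s) /\ cancel (psi s) (phi0 s)) /\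
    two_param_flow J (fun s t => phi0 t \o psi s).
Proof.
have J0 := Jset0 T0.
have EX s v : exists v0, J s -> phi0 s v0 = v.
  have [Js|nJ] := pselect (J s); last by exists v.
  have [x [xP xs]] := is_solution_target v Js.
  by exists (x 0) => _; rewrite -evol_unique.
pose psi s v := projT1 (cid (EX s v)).
have psiK s : J s -> cancel (psi s) (phi0 s).
  by move=> Js v; apply: (projT2 (cid (EX s v))).
have phiK s : J s -> cancel (phi0 s) (psi s).
  move=> Js v; have [P1 P2] := evolP v; have [P3 P4] := evolP (psi s (phi0 s v)).
  rewrite -[RHS]P2 -[LHS]P4; apply: (is_solution_unique P3 P1 Js J0).
  by rewrite psiK.
split; first by move=> t Jt; exists (psi t); [exact: phiK | exact: psiK].
exists psi; split; first by move=> s Js; split; [exact: phiK | exact: psiK].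
have cont : {within [set p : R * R * 'cV[R]_d | J p.1.1 /\ J p.1.2],
    continuous (fun p : R * R * 'cV[R]_d => phi0 p.1.2 (psi p.1.1 p.2))}.
  apply/subspace_continuousP => -[[s t] v]/= [Js Jt].
  apply/cvgrPdist_le => e e0.
  have [taus Jtaus Htaus] := Jset_local Js.
  have [taut Jtaut Htaut] := Jset_local Jt.
  have [C C0 HC] := is_solution_two_sided (Jset_max Jtaus Jtaut).
  (* [z] is the fixed solution through [v] at [s]. At a nearby [(s', t', v')] the two-sided estimate
     bounds the distance to [z t'] by [C] times that from [v'] to [z s']; continuity of [z] at [s]
     and at [t] finishes, with three shares of [e / 3]. *)
  pose z := phi0 ^~ (psi s v).
  have [zP z0] := evolP (psi s v).
  have /subspace_continuousP cz := zP.1.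
  have e3 : 0 < e / (3 * C) by rewrite divr_gt0// mulr_gt0.
  have e3' : 0 < e / 3 by lra.
  have := cz s Js; move/cvgrPdist_le => /(_ _ e3); rewrite near_withinE => Ns.
  have := cz t Jt; move/cvgrPdist_le => /(_ _ e3'); rewrite near_withinE => Nt.
  have Nv := near_dist_lt v e3.
  have Ls := near_dist_lt s ltr01.
  have Lt := near_dist_lt t ltr01.
  rewrite near_withinE.
  have N1 : \forall p \near ((s, t), v),
      (J p.1.1 -> `|phi0 s (psi s v) - phi0 p.1.1 (psi s v)| <= e / (3 * C)) /\
      `|s - p.1.1| < 1.
    exists ([set q | (J q.1 -> `|phi0 s (psi s v) - phi0 q.1 (psi s v)| <= e / (3 * C)) /\
      `|s - q.1| < 1], setT) => /=.
      split; last exact: filterT.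
      exists ([set q | (J q -> `|phi0 s (psi s v) - phi0 q (psi s v)| <= e / (3 * C)) /\
        `|s - q| < 1], setT) => /=; last by move=> [? ?] [].
      by split; [apply: filterI | exact: filterT].
    by move=> [? ?] [].
  have N2 : \forall p \near ((s, t), v),
      (J p.1.2 -> `|phi0 t (psi s v) - phi0 p.1.2 (psi s v)| <= e / 3) /\
      `|t - p.1.2| < 1.
    exists ([set q | (J q.2 -> `|phi0 t (psi s v) - phi0 q.2 (psi s v)| <= e / 3) /\
      `|t - q.2| < 1], setT) => /=.
      split; last exact: filterT.
      exists (setT, [set q | (J q -> `|phi0 t (psi s v) - phi0 q (psi s v)| <= e / 3) /\
        `|t - q| < 1]) => /=; last by move=> [? ?] [].
      by split; [exact: filterT | apply: filterI].
    by move=> [? ?] [].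
  have N3 : \forall p \near ((s, t), v), `|v - p.2| < e / (3 * C).
    exists (setT, [set v' | `|v - v'| < e / (3 * C)]) => /=; last by move=> [? ?] [].
    by split => //; exact: filterT.
  move: N1 N2 N3; apply: filterS3 => -[[s' t'] v']/= [h1 l1] [h2 l2] h3 [Js' Jt'].
  have [z'P z'0] := evolP (psi s' v').
  have Bs : 0 <= s' <= Num.max taus taut.
    by case: (Js') => -> _; rewrite le_max (Htaus _ Js' l1).
  have Bt : 0 <= t' <= Num.max taus taut.
    by case: (Jt') => -> _; rewrite le_max (Htaut _ Jt' l2) orbT.
  have K := HC _ _ zP z'P s' t' Bs Bt.
  rewrite psiK// in K.
  have -> : phi0 t (psi s v) - phi0 t' (psi s' v') =
    (phi0 t (psi s v) - phi0 t' (psi s v)) + (phi0 t' (psi s v) - phi0 t' (psi s' v')).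
    by rewrite addrA subrK.
  apply: le_trans (ler_normD _ _) _.
  have K2 : `|phi0 s' (psi s v) - v'| <= e / (3 * C) + e / (3 * C).
    have -> : phi0 s' (psi s v) - v' = (v - v') - (v - phi0 s' (psi s v)).
      by rewrite opprB [RHS]addrC addrA subrK.
    apply: le_trans (ler_normB _ _) _; apply: lerD; first exact: ltW.
    by rewrite -{1}(psiK s Js v); apply: h1.
  apply: (@le_trans _ _ (e / 3 + C * (e / (3 * C) + e / (3 * C)))).
    apply: lerD; first exact: h2.
    by apply: le_trans K _; rewrite ler_pM2l.
  rewrite (_ : C * _ = 2 * (e / 3)); last by field; rewrite gt_eqF.
  lra.
have cslice s t : J s -> J t -> continuous (phi0 t \o psi s).
  move=> Js Jt.
  have := @continuous_comp_within _ _ _ _ _ (fun v : 'cV[R]_d => ((s, t), v)) cont.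
  apply => // v.
  by apply: (@cvg_pair _ _ _ (nbhs v) (nbhs (s, t)) (nbhs v)) => //; exact: cvg_cst.
split => //.
- move=> s t Js Jt; exists (phi0 s \o psi t); split; try exact: cslice.
  + by move=> v /=; rewrite phiK// psiK.
  + by move=> v /=; rewrite phiK// psiK.
- by move=> u s t Ju Js Jt; apply/funext => v /=; rewrite phiK.
Qed.

End TriangularFlow.

(** * The nonlinear and the linear system as instances *)

Section Instances.
Context {R : realType} (alpha : R) (d : nat) (T : \bar R).
Local Notation J := (Jset T).

Lemma continuous_within_clamp (V : topologicalType) (L : R -> V) tau :
  {within J, continuous L} -> J tau -> continuous (fun t => L (clamp tau t)).
Proof.
move=> cL Jt; apply: (continuous_comp_within cL); first exact: continuous_clamp.
by move=> t; exact: Jset_clamp.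
Qed.

Lemma clamp_bounded (V : normedModType R) (L : R -> V) tau :
  {within J, continuous L} -> J tau ->
  exists2 M, 0 <= M & forall t, `|L (clamp tau t)| <= M.
Proof.
move=> cL Jt; have [tau0 _] := Jt.
have cn : continuous (fun t => `|L (clamp tau t)|).
  move=> t; apply: (@continuous_comp _ _ _ (fun t => L (clamp tau t)) (@Num.norm _ V)).
    exact: continuous_within_clamp.
  exact: norm_continuous.
have [M HM] := @continuous_bounded_itv R _ 0 tau cn.
have H t : `|L (clamp tau t)| <= M.
  have c := clamp_itv t tau0.
  by have := HM _ c; rewrite normr_id (clamp_id c).
by exists M => //; apply: le_trans (H 0); exact: normr_ge0.
Qed.

Lemma enorm_le n (v : 'cV[R]_n) (B : R) : 0 <= B -> (forall i, `|v i 0| <= B) ->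
  enorm v <= n%:R * B.
Proof.
move=> B0 vB; rewrite /enorm -(@ger0_norm _ (n%:R * B)) ?mulr_ge0//.
rewrite -sqrtr_sqr; apply: ler_wsqrtr.
apply: (@le_trans _ _ (\sum_(j < n) B ^+ 2)).
  apply: ler_sum => i _; rewrite -real_normK ?num_real// ler_sqr ?nnegrE//; exact: vB.
rewrite sumr_const card_ord -[leLHS]mulr_natl exprMn ler_wpM2r ?exprn_ge0//.
by rewrite -natrX ler_nat; case: n {v vB} => // n; rewrite -{1}[n.+1]expn1 leq_pexp2l.
Qed.

Lemma tri_field_tri_rhs (f : forall i : 'I_d, R -> 'cV[R]_i.+1 -> R) (L : R -> R) tau :
  (forall i : 'I_d, {within J `*` setT,
     continuous (fun p : R * 'cV[R]_i.+1 => f i p.1 p.2)}) ->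
  {within J, continuous L} ->
  (forall (i : 'I_d) t (x y : 'cV[R]_i.+1), J t ->
     `|f i t x - f i t y| <= L t * enorm (x - y)) ->
  J tau -> exists2 Lam, 0 <= Lam &
    tri_rhs (@nat_of_ord d) Lam (fun t => tri_field f (clamp tau t)).
Proof.
move=> cf cL fL Jt; have [M M0 HM] := clamp_bounded cL Jt.
(* [M] bounds [L] on [[0, tau]]; the factor [d] passes from the Euclidean to the sup norm. *)
exists (M * d%:R); first by rewrite mulr_ge0.
split.
- move=> X cX i.
  rewrite (_ : (fun t => _) = (fun p : R * 'cV[R]_i.+1 => f i p.1 p.2) \o
    (fun t => (clamp tau t, \col_(j < i.+1) X t (widen_ord (ltn_ord i) j) 0))); last first.
    by apply/funext => t; rewrite mxE.
  apply: (continuous_comp_within (cf i)); last by move=> t; split => //=; exact: Jset_clamp.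
  have cY : continuous (fun t => \col_(j < i.+1) X t (widen_ord (ltn_ord i) j) 0).
    apply/path_continuousP => j.
    rewrite (_ : (fun t => _) = fun t => X t (widen_ord (ltn_ord i) j) 0)//.
    by apply/funext => t; rewrite mxE.
  move=> t; apply: (@cvg_pair _ _ _ (nbhs t) (nbhs (clamp tau t))
    (nbhs (\col_(j < i.+1) X t (widen_ord (ltn_ord i) j) 0))).
    exact: continuous_clamp.
  exact: cY.
- move=> t v w B i vw; rewrite !mxE.
  have B0 : 0 <= B by apply: le_trans (vw i); exact: normr_ge0.
  apply: le_trans (fL i _ _ _ (Jset_clamp t Jt)) _.
  apply: (@le_trans _ _ (M * enorm ((\col_(j < i.+1) v (widen_ord (ltn_ord i) j) 0) -
      (\col_(j < i.+1) w (widen_ord (ltn_ord i) j) 0)))).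
    rewrite ler_wpM2r ?sqrtr_ge0//.
    by apply: le_trans (HM t); exact: ler_norm.
  rewrite -mulrA ler_wpM2l//.
  apply: le_trans (enorm_le B0 _) _; first by move=> j; rewrite !mxE.
  by rewrite ler_wpM2r// ler_nat.
- move=> t v w i vw; rewrite !mxE; congr f.
  by apply/colP => j; rewrite !mxE; apply: vw; rewrite /= -ltnS.
Qed.

Lemma linear_tri_rhs (rk : 'I_d -> nat) (A : R -> 'M[R]_d) tau :
  {within J, continuous A} ->
  (forall t, J t -> forall i j, (rk i < rk j)%N -> A t i j = 0) ->
  J tau -> exists2 Lam, 0 <= Lam & tri_rhs rk Lam (fun t v => A (clamp tau t) *m v).
Proof.
move=> cA A0 Jt; have [M M0 HM] := clamp_bounded cA Jt.
exists (d%:R * M); first by rewrite mulr_ge0.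
split.
- move=> X cX i.
  rewrite (_ : (fun t => _) = (fun t => \sum_j A (clamp tau t) i j * X t j 0)); last first.
    by apply/funext => t; rewrite mxE.
  move=> t; apply: cvg_big => [|j _]; first exact: add_continuous.
  apply: cvgM; last exact: cX.
  apply: (@continuous_comp _ _ _ (fun r => A (clamp tau r)) (fun B : 'M[R]_d => B i j)).
    exact: continuous_within_clamp.
  exact: coord_continuous.
- move=> t v w B i vw; rewrite !mxE -sumrB.
  apply: le_trans (ler_norm_sum _ _ _) _.
  apply: (@le_trans _ _ (\sum_(j < d) M * B)).
    apply: ler_sum => j _; rewrite -mulrBr normrM; apply: ler_pM => //.
    by apply: le_trans (HM t); exact: coord_le_norm.
  by rewrite sumr_const card_ord -[leLHS]mulr_natl mulrA.
- move=> t v w i vw; rewrite !mxE; apply: eq_bigr => j _.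
  have [/vw -> //|ij] := leqP (rk j) (rk i).
  by rewrite A0 ?mul0r//; exact: Jset_clamp.
Qed.

Lemma is_solution_linear (A : R -> 'M[R]_d) (x y : R -> 'cV[R]_d) (a : R) :
  is_solution alpha J (fun t v => A t *m v) x ->
  is_solution alpha J (fun t v => A t *m v) y ->
  is_solution alpha J (fun t v => A t *m v) (fun t => a *: x t + y t).
Proof.
move=> [cx xE] [cy yE]; split.
  apply/subspace_continuousP => t Jt; apply: cvgD; last by move/subspace_continuousP: cy; exact.
  by apply: cvgZr; move/subspace_continuousP: cx; exact.
move=> t Jt i; have [ix xEt] := xE t Jt i; have [iy yEt] := yE t Jt i.
have E tau : (t - tau) `^ (alpha - 1) * (A tau *m (a *: x tau + y tau)) i 0 =
    a * ((t - tau) `^ (alpha - 1) * (A tau *m x tau) i 0) +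
    (t - tau) `^ (alpha - 1) * (A tau *m y tau) i 0.
  by rewrite mulmxDr -scalemxAr !mxE mulrDr mulrCA.
have iax : (@lebesgue_measure R).-integrable `[0, t]
    (fun tau => (a%:E * ((t - tau) `^ (alpha - 1) * (A tau *m x tau) i 0)%:E)%E).
  by apply: integrableZl.
split.
  apply: eq_integrable; last exact: (integrableD _ iax iy).
    exact: measurable_itv.
  by move=> r _; rewrite /= E.
rewrite !mxE xEt yEt; under [in RHS]eq_Rintegral => r _ do rewrite E.
rewrite RintegralD// RintegralZl//; ring.
Qed.

Lemma linear_fun_mx n (g : 'cV[R]_n -> 'cV[R]_n) :
  (forall a u v, g (a *: u + v) = a *: g u + g v) ->
  exists M : 'M[R]_n, forall v, g v = M *m v.
Proof.
move=> gl.
have g0 : g 0 = 0.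
  have := gl (-1) 0 0; rewrite scaleN1r oppr0 addr0 scaleN1r.
  by rewrite addrC subrr.
have gD : {morph g : u v / u + v} by move=> u v; have := gl 1 u v; rewrite !scale1r.
have gZ a u : g (a *: u) = a *: g u by have := gl a u 0; rewrite !addr0 g0 addr0.
exists (\matrix_(i, j) g (delta_mx j 0) i 0) => v.
rewrite {1}(matrix_sum_delta v) (big_morph g gD g0).
apply/colP => i; rewrite summxE mxE; apply: eq_bigr => j _.
by rewrite big_ord1 gZ !mxE mulrC.
Qed.

End Instances.

Theorem mainTheorem9 (R : realType) (d : nat) (alpha : R) (T : \bar R) :
  (1 <= d)%N -> 0 < alpha < 1 -> (0 < T)%E ->
  (* (i) triangular nonlinear systems *)
  (forall (f : forall i : 'I_d, R -> 'cV[R]_i.+1 -> R) (L : R -> R),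
     (forall i : 'I_d, {within Jset T `*` setT,
        continuous (fun p : R * 'cV[R]_i.+1 => f i p.1 p.2)}) ->
     {within Jset T, continuous L} ->
     (forall t, Jset T t -> 0 <= L t) ->
     (forall (i : 'I_d) t (x y : 'cV[R]_i.+1), Jset T t ->
        `|f i t x - f i t y| <= L t * enorm (x - y)) ->
     let phi0 := evol alpha (Jset T) (tri_field f) in
     (forall t, Jset T t -> bijective (phi0 t)) /\
     exists psi : R -> 'cV[R]_d -> 'cV[R]_d,
       (forall s, Jset T s -> cancel (phi0 s) (psi s) /\ cancel (psi s) (phi0 s)) /\
       two_param_flow (Jset T) (fun s t => phi0 t \o psi s)) /\
  (* (ii) triangular linear systems *)
  (forall (A : R -> 'M[R]_d) (L : R -> R),
     {within Jset T, continuous A} ->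
     (exists M : R, forall t, Jset T t -> opnorm (A t) <= M) ->
     ((forall t, Jset T t -> forall i j : 'I_d, (j < i)%N -> A t i j = 0) \/
      (forall t, Jset T t -> forall i j : 'I_d, (i < j)%N -> A t i j = 0)) ->
     {within Jset T, continuous L} ->
     (forall t, Jset T t -> 0 <= L t) ->
     (forall t, Jset T t -> opnorm (A t) <= L t) ->
     let phi0 := evol alpha (Jset T) (fun t x => A t *m x) in
     (forall t, Jset T t -> bijective (phi0 t)) /\
     exists psi : R -> 'cV[R]_d -> 'cV[R]_d,
       (forall s, Jset T s -> cancel (phi0 s) (psi s) /\ cancel (psi s) (phi0 s)) /\
       two_param_flow (Jset T) (fun s t => phi0 t \o psi s) /\
       (forall s t, Jset T s -> Jset T t ->
          exists M : 'M[R]_d, M \in unitmx /\ forall x, (phi0 t \o psi s) x = M *m x)).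
Proof.
move=> _ alpha01 T0; split.
  move=> f L cf cL _ fL.
  apply: (@triangular_flow _ _ _ (@nat_of_ord d)) => //; first exact: ord_inj.
  by move=> tau; exact: tri_field_tri_rhs cf cL fL.
move=> A L cA _ triA _ _ _ phi0.
have [rk rk_inj rkA] : exists2 rk : 'I_d -> nat, injective rk &
    forall t, Jset T t -> forall i j, (rk i < rk j)%N -> A t i j = 0.
  case: triA => triA.
    (* With zeros below the diagonal, row [i] involves only coordinates [j >= i], so the system is
       solved from the last coordinate upwards. *)
    exists (fun i => nat_of_ord (rev_ord i)).
      by move=> i j /ord_inj /rev_ord_inj.
    move=> t Jt i j; rewrite /= => h; apply: triA => //.
    by have := ltn_ord i; have := ltn_ord j; move: h; lia.
  by exists (@nat_of_ord d) => //; exact: ord_inj.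
pose F t (v : 'cV[R]_d) : 'cV[R]_d := A t *m v.
have F_tri tau : Jset T tau -> exists2 Lam, 0 <= Lam &
    tri_rhs rk Lam (fun t => F (clamp tau t)).
  exact: linear_tri_rhs.
have [bij [psi [psiP flow]]] := @triangular_flow _ _ _ _ _ F alpha01 rk_inj T0 F_tri.
split => //; exists psi; split => //; split => // s t Js Jt.
have phiL r a u v : Jset T r -> phi0 r (a *: u + v) = a *: phi0 r u + phi0 r v.
  move=> Jr.
  have [uP u0] := @evolP _ _ _ _ _ F alpha01 rk_inj T0 F_tri u.
  have [vP v0] := @evolP _ _ _ _ _ F alpha01 rk_inj T0 F_tri v.
  have := @evol_unique _ _ _ _ _ F alpha01 rk_inj T0 F_tri _ r (is_solution_linear a uP vP) Jr.
  by rewrite /= u0 v0 => ->.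
have psiL r a u v : Jset T r -> psi r (a *: u + v) = a *: psi r u + psi r v.
  move=> Jr; have [K1 K2] := psiP r Jr.
  by rewrite -{1}(K2 u) -{1}(K2 v) -phiL// K1.
have mxP r q : Jset T r -> Jset T q ->
    exists M : 'M[R]_d, forall x, (phi0 q \o psi r) x = M *m x.
  by move=> Jr Jq; apply: linear_fun_mx => a u v /=; rewrite psiL// phiL.
have [M MP] := mxP s t Js Jt; have [N NP] := mxP t s Jt Js.
exists M; split => //.
(* [N] represents the map from time [t] back to time [s], so the product fixes every unit vector. *)
suff : M *m N = 1%:M by case/mulmx1_unit.
apply/matrixP => i j.
have : M *m N *m delta_mx j 0 = delta_mx j 0 :> 'cV[R]_d.
  rewrite -mulmxA -NP -MP /=.
  by have [K1 _] := psiP s Js; have [_ K2] := psiP t Jt; rewrite K1; exact: K2.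
move/colP => /(_ i).
rewrite -colE !mxE => ->; by rewrite eqxx andbT.
Qed.
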